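(* Let $\sim_{\mathrm{orb}}$ denote orbifold equivalence of potentials over $\mathbb{C}$ in three variables $x,y,z$. Then the following orbifold equivalences hold between different potentials describing the same exceptional unimodal singularity: (1) ($Q_{12}$) $\; x^3z+y^3+xz^2 \;\sim_{\mathrm{orb}}\; x^5+y^3+xz^2$; (2) ($U_{12}$) $\; x^4+y^3+z^3 \;\sim_{\mathrm{orb}}\; x^4+y^3+z^2y \;\sim_{\mathrm{orb}}\; x^4+y^2z+z^2y$; (3) ($W_{12}$) $\; x^5+y^2z+z^2 \;\sim_{\mathrm{orb}}\; x^5+y^4+z^2$; (4) ($W_{13}$) $\; yx^4+y^2z+z^2 \;\sim_{\mathrm{orb}}\; x^4y+y^4+z^2$; (5) ($Z_{13}$) $\; x^3z+xy^3+z^2 \;\sim_{\mathrm{orb}}\; x^6+y^3x+z^2$.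
   Context: **Potentials.** A potential is a polynomial $W\in\mathbb{C}[x_1,\dots,x_n]$ with an isolated singularity at the origin which, for a given assignment of positive rational degrees $|x_i|$ to the variables, is homogeneous of degree $2$: $W(\lambda^{|x_1|}x_1,\dots,\lambda^{|x_n|}x_n)=\lambda^2W(x_1,\dots,x_n)$ for all $\lambda\in\mathbb{C}^\times$. For the potentials in the claim, the degrees $(|x|,|y|,|z|)$ are the same for all potentials of a given singularity: $Q_{12}$: $(\tfrac{6}{15},\tfrac{10}{15},\tfrac{12}{15})$; $U_{12}$: $(\tfrac{6}{12},\tfrac{8}{12},\tfrac{8}{12})$; $W_{12}$: $(\tfrac{8}{20},\tfrac{10}{20},\tfrac{20}{20})$; $W_{13}$: $(\tfrac{6}{16},\tfrac{8}{16},\tfrac{16}{16})$; $Z_{13}$: $(\tfrac{6}{18},\tfrac{10}{18},\tfrac{18}{18})$. **Matrix factorizations.** Let $S$ be a polynomial ring over $\mathbb{C}$ and $F\in S$. A matrix factorization of $F$ is a pair $(M,d^M)$, where $M=M_0\oplus M_1$ is a $\mathbb{Z}_2$-graded free $S$-module and $d^M\colon M\to M$ is an $S$-linear endomorphism of $\mathbb{Z}_2$-degree $1$ with $d^M\circ d^M=F\cdot\mathrm{id}_M$. It has finite rank if $M$ has finite rank. If the variables of $S$ carry rational degrees, the matrix factorization is graded if in addition $M_0$ and $M_1$ are $\mathbb{Q}$-graded, multiplication by each variable $x_i$ is an endomorphism of $\mathbb{Q}$-degree $|x_i|$, and $d^M$ has $\mathbb{Q}$-degree $1$. **Quantum dimensions.**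 Let $V(x_1,\dots,x_m)$ and $W(y_1,\dots,y_n)$ be potentials in disjoint sets of variables, and let $M$ be a finite-rank matrix factorization of $W-V$ over $\mathbb{C}[x_1,\dots,x_m,y_1,\dots,y_n]$. Choose a basis of $M$ compatible with the $\mathbb{Z}_2$-grading, so that $d^M$ is a matrix, and let $\partial_{x_i}d^M$, $\partial_{y_j}d^M$ be its entrywise partial derivatives. The left and right quantum dimensions of $M$ are $$\mathrm{qdim}_l(M)=(-1)^{\binom{m+1}{2}}\,\mathrm{Res}\left[\frac{\mathrm{str}\big(\partial_{x_1}d^M\cdots\partial_{x_m}d^M\,\partial_{y_1}d^M\cdots\partial_{y_n}d^M\big)\,dy_1\cdots dy_n}{\partial_{y_1}W,\dots,\partial_{y_n}W}\right],$$ $$\mathrm{qdim}_r(M)=(-1)^{\binom{n+1}{2}}\,\mathrm{Res}\left[\frac{\mathrm{str}\big(\partial_{x_1}d^M\cdots\partial_{x_m}d^M\,\partial_{y_1}d^M\cdots\partial_{y_n}d^M\big)\,dx_1\cdots dx_m}{\partial_{x_1}V,\dots,\partial_{x_m}V}\right].$$ Here $\mathrm{str}$ is the supertrace (trace on $M_0$ minus trace on $M_1$), and $\mathrm{Res}$ is the Grothendieck residue, in the first formula with respect to the $y$-variables over the coefficient ring $\mathbb{C}[x_1,\dots,x_m]$, in the second with respect to the $x$-variables over $\mathbb{C}[y_1,\dots,y_n]$. Concretely, if $y_i^{N_i}=\sum_j c_{ij}\,\partial_{y_j}W$ with polynomials $c_{ij}$, then $\mathrm{Res}\left[\frac{f\,dy_1\cdots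 dy_n}{\partial_{y_1}W,\dots,\partial_{y_n}W}\right]$ is the coefficient of $y_1^{N_1-1}\cdots y_n^{N_n-1}$ in $f\cdot\det(c_{ij})$, and similarly in the $x$-variables. For graded matrix factorizations and the degrees used here, the quantum dimensions are complex numbers. **Orbifold equivalence.** Two potentials $V$ and $W$ are orbifold equivalent, $V\sim_{\mathrm{orb}}W$, if, after renaming variables so that $V$ and $W$ are in disjoint sets of variables, there exists a finite-rank graded matrix factorization $M$ of $W-V$ (over the polynomial ring in all the variables, each carrying its given degree) such that both $\mathrm{qdim}_l(M)\neq 0$ and $\mathrm{qdim}_r(M)\neq 0$. This is an equivalence relation on potentials. *)

(* Defs.v *)
From mathcomp Require Import all_boot all_order all_algebra.
From mathcomp Require Import complex classical_sets reals.
From mathcomp Require Import mpoly.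

Set Implicit Arguments.
Unset Strict Implicit.
Unset Printing Implicit Defensive.

Import Order.TTheory GRing.Theory Num.Theory.

Local Open Scope ring_scope.

Section Potentials.
Variables (R : realType) (n : nat).
Local Notation C := R[i].

(* A consistent choice of the rational powers r |-> lambda^r of a nonzero
   complex number lambda = pw 1, i.e. a homomorphism (rat, +) -> C^x. As C^x is
   divisible, every lambda != 0 is pw 1 for at least one such pw. *)
Definition rational_power (pw : rat -> C) : Prop :=
  pw 1 != 0 /\ forall r s, pw (r + s) = pw r * pw s.

(* W(lambda^w_0 x_0, ..., lambda^w_(n-1) x_(n-1)) = lambda^2 W(x), for every
   lambda != 0 and every choice of its rational powers. *)
Definition homogeneous2 (w : n.-tuple rat) (W : {mpoly C[n]}) : Prop :=
  forall pw : rat -> C, rational_power pw ->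
    W \mPo [tuple pw (tnth w i) *: 'X_i | i < n] = (pw 1) ^+ 2 *: W.

Definition critical_point (W : {mpoly C[n]}) (v : 'I_n -> C) : Prop :=
  forall i : 'I_n, (W^`M(i)).@[v] = 0.

Definition isolated_singularity_at_0 (W : {mpoly C[n]}) : Prop :=
  [/\ W.@[fun=> 0] = 0,
      critical_point W (fun=> 0) &
      exists2 e : C, 0 < e & forall v : 'I_n -> C,
        (forall i, `|v i| < e) -> critical_point W v -> forall i, v i = 0].

Definition potential (w : n.-tuple rat) (W : {mpoly C[n]}) : Prop :=
  [/\ forall i, 0 < tnth w i, homogeneous2 w W & isolated_singularity_at_0 W].

End Potentials.

(* The free module M_0 (+) M_1 with M_0 = S^mf_rk0 and M_1 = S^mf_rk1 (column
   vectors); mf_d is the matrix of the differential in the standard basis. *)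
Record matrix_factorization (S : comNzRingType) (F : S) := MatrixFactorization {
  mf_rk0 : nat;
  mf_rk1 : nat;
  mf_d : 'M[S]_(mf_rk0 + mf_rk1);
  mf_odd : ulsubmx mf_d = 0 /\ drsubmx mf_d = 0;
  mf_sq : mf_d *m mf_d = F%:M
}.

Definition supertrace (S : comNzRingType) (p q : nat) (A : 'M[S]_(p + q)) : S :=
  \tr (ulsubmx A) - \tr (drsubmx A).

(* G makes the K[x_0, ..., x_(n-1)]-module V a rat-graded module, where K sits
   in degree 0 and x_i has degree w_i: G q is the space of homogeneous elements
   of degree q, and V is the direct sum of the G q. *)
Record grading (K : comNzRingType) (n : nat) (w : n.-tuple rat)
    (V : lmodType {mpoly K[n]}) (G : rat -> V -> Prop) : Prop := Grading {
  grading0 : forall q, G q 0;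
  gradingD : forall q u v, G q u -> G q v -> G q (u + v);
  gradingZ : forall q (a : K) v, G q v -> G q (a%:MP_[n] *: v);
  gradingX : forall q (i : 'I_n) v, G q v -> G (q + tnth w i) ('X_i *: v);
  grading_sum : forall v, exists (s : seq rat) (c : rat -> V),
    [/\ uniq s, forall q, G q (c q) & v = \sum_(q <- s) c q];
  grading_direct : forall (s : seq rat) (c : rat -> V),
    uniq s -> (forall q, G q (c q)) -> \sum_(q <- s) c q = 0 ->
    forall q, q \in s -> c q = 0
}.

(* mf_d maps M_0 to M_1 by its lower left block and M_1 to M_0 by its upper
   right block. *)
Definition graded_mf (K : comNzRingType) (n : nat) (w : n.-tuple rat)
    (F : {mpoly K[n]}) (M : matrix_factorization F) : Prop :=
  exists (G0 : rat -> 'cV[{mpoly K[n]}]_(mf_rk0 M) -> Prop)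
         (G1 : rat -> 'cV[{mpoly K[n]}]_(mf_rk1 M) -> Prop),
    [/\ grading w G0, grading w G1,
        forall q v, G0 q v -> G1 (q + 1) (dlsubmx (mf_d M) *m v) &
        forall q v, G1 q v -> G0 (q + 1) (ursubmx (mf_d M) *m v)].

(* The Grothendieck residue Res [f dy_0 ... dy_(n-1) / g_0, ..., g_(n-1)] over
   the coefficient ring A. When y_i^(N i) = \sum_j c_ij g_j, it is the
   coefficient of y^(N - 1) in f det c; this value does not depend on N and c,
   so [xget] selects it (and is 0 if no such N and c exist). *)
Definition residue (A : comNzRingType) (n : nat)
    (f : {mpoly A[n]}) (g : 'I_n -> {mpoly A[n]}) : A :=
  xget 0 [set r : A |
    exists (N : 'X_{1..n}) (c : 'M[{mpoly A[n]}]_n),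
      [/\ forall i, (0 < N i)%N,
          forall i, 'X_i ^+ N i = \sum_j c i j * g j &
          r = (f * \det c)@_[multinom (N i).-1 | i < n]]]%classic.

(* K[x, y] has the variables x_i = 'X_(lshift n i) with i < m, followed by
   y_j = 'X_(rshift m j) with j < n. *)
Section TwoSetsOfVariables.
Variables (K : comNzRingType) (m n : nat).

Definition inx (V : {mpoly K[m]}) : {mpoly K[m + n]} :=
  V \mPo [tuple 'X_(lshift n i) | i < m].

Definition iny (W : {mpoly K[n]}) : {mpoly K[m + n]} :=
  W \mPo [tuple 'X_(rshift m j) | j < n].

(* The isomorphisms K[x, y] -> K[x][y] and K[x, y] -> K[y][x]. *)
Definition to_Kx_y (p : {mpoly K[m + n]}) : {mpoly {mpoly K[m]}[n]} :=
  mmap (fun a : K => (a%:MP_[m])%:MP_[n])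
       (fun k => match split k with
                 | inl i => ('X_i)%:MP_[n]
                 | inr j => 'X_j
                 end) p.

Definition to_Ky_x (p : {mpoly K[m + n]}) : {mpoly {mpoly K[n]}[m]} :=
  mmap (fun a : K => (a%:MP_[n])%:MP_[m])
       (fun k => match split k with
                 | inl i => 'X_i
                 | inr j => ('X_j)%:MP_[m]
                 end) p.

Variables (V : {mpoly K[m]}) (W : {mpoly K[n]}).
Variable M : matrix_factorization (iny W - inx V).

(* str (d_x0 d^M ... d_x(m-1) d^M d_y0 d^M ... d_y(n-1) d^M) *)
Definition str_derivatives : {mpoly K[m + n]} :=
  supertrace (\prod_(k < m + n) map_mx (mderiv k) (mf_d M)).

Definition qdiml : {mpoly K[m]} :=
  (-1) ^+ 'C(m.+1, 2) *
  residue (to_Kx_y str_derivatives) (fun j => to_Kx_y (iny (W^`M(j)))).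

Definition qdimr : {mpoly K[n]} :=
  (-1) ^+ 'C(n.+1, 2) *
  residue (to_Ky_x str_derivatives) (fun i => to_Ky_x (inx (V^`M(i)))).

End TwoSetsOfVariables.

Definition orbifold_equivalent (R : realType) (m n : nat)
    (wV : m.-tuple rat) (V : {mpoly R[i][m]})
    (wW : n.-tuple rat) (W : {mpoly R[i][n]}) : Prop :=
  [/\ potential wV V, potential wW W &
      exists M : matrix_factorization (iny m W - inx n V),
        [/\ graded_mf [tuple of wV ++ wW] M, qdiml M != 0 & qdimr M != 0]].

Definition degrees3 (a b c : rat) : 3.-tuple rat := [tuple a; b; c].

(* Main.v *)
(* In each case W = V o phi for a graded automorphism phi of the coordinates
   (complete a square, or use that binary cubics with distinct roots are
   equivalent). So W(y) - V(x) = \sum_i a_i b_i with a_i = phi_i(y) - x_i and b_i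
   difference quotients of V, and the Koszul factorization of the pairs (a_i, b_i)
   is a graded matrix factorization. The supertrace in its quantum dimensions is,
   by Clifford algebra, the determinant of D = d_y b + (d_y phi)(d_x b). At x = 0,
   differentiating \sum_i a_i b_i gives dW = D phi, so the transformation law turns
   Res [det D / dW] into Res [1 / phi], the inverse Jacobian determinant of phi at
   0; at y = 0 one gets likewise (d phi)(0) dV = D x. *)

(* A quantum dimension is formally a polynomial in the other set of variables, and only its being
   nonzero matters. Hence its value at the origin suffices, and no argument that it is constant is
   made.

   Since [residue] is a choice from a set, it must be shown that the value depends neither on the
   exponents nor on the cofactors. This is done over an arbitrary commutative ring, because the
   coefficients are themselves polynomials; a single datum over the field then computes both the
   residue over the polynomial ring and its value at 0.

   The existence of such data is not deduced from the isolatedness of the singularity. For every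
   potential, explicit powers of the variables are written as combinations of the partial
   derivatives, and isolatedness is read off from the same identities.

   The two sides are not symmetric: at x = 0 the relation between dW and [phi] yields the residue
   directly, whereas at y = 0 the residue appears as one factor of Res [1 / x] = 1. *)
Require Import Defs.
From HB Require Import structures.
From mathcomp Require Import all_boot all_order all_algebra.
From mathcomp Require Import complex boolp classical_sets reals ring.
From mathcomp Require Import mpoly.

Set Implicit Arguments.
Unset Strict Implicit.
Unset Printing Implicit Defensive.

Import Order.TTheory GRing.Theory Num.Theory.
Local Open Scope ring_scope.

(** * Grothendieck residues *)

Section Residue.
Variables (A : comNzRingType) (n : nat).
Implicit Types (f : {mpoly A[n]}) (g : 'I_n -> {mpoly A[n]}).
Implicit Types (N : 'X_{1..n}) (c : 'M[{mpoly A[n]}]_n).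

Definition residue_datum g N c :=
  (forall i, (0 < N i)%N) /\ forall i, 'X_i ^+ N i = \sum_j c i j * g j.

Definition pred_mnm N : 'X_{1..n} := [multinom (N i).-1 | i < n].

Lemma mcoeffMXn_lt f i k (m : 'X_{1..n}) :
  (m i < k)%N -> (f * 'X_i ^+ k)@_m = 0.
Proof.
move=> lt_mk; rewrite (mpolyE f) mulr_suml raddf_sum big1_seq //= => m1 _.
rewrite mpolyXn -scalerAl -mpolyXD mcoeffZ mcoeffX.
case: eqP => [def_m | _]; last by rewrite mulr0.
move: lt_mk; rewrite -def_m mnmDE mulmnE mnm1E eqxx mul1n.
by rewrite ltnNge leq_addl.
Qed.

(* Cramer's rule puts [\det c * g j] in the ideal of the ['X_k ^+ N k], k != i0;
   so it contains ['X_i0 ^+ N i0 * \det c], and ['X_i0] is regular modulo that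
   ideal. *)
Lemma residue_syzygy f g N c (i0 : 'I_n) (r : 'I_n -> {mpoly A[n]}) :
  (forall i, (0 < N i)%N) ->
  (forall i, i != i0 -> 'X_i ^+ N i = \sum_j c i j * g j) ->
  \sum_j c i0 j * g j = 0 -> 'X_i0 ^+ N i0 = \sum_j r j * g j ->
  (f * \det c)@_(pred_mnm N) = 0.
Proof.
move=> N_gt0 cg cg0 rg.
have detg j : \det c * g j = \sum_(k | k != i0) (\adj c) j k * 'X_k ^+ N k.
  have : ((\adj c *m c) *m \col_j g j) j 0 = \det c * g j.
    by rewrite mul_adj_mx mul_scalar_mx !mxE.
  rewrite -mulmxA => <-; rewrite mxE [LHS](bigD1 i0) //= !mxE.
  under [X in _ * X]eq_bigr do rewrite mxE.
  rewrite cg0 mulr0 add0r; apply: eq_bigr => k kNi0.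
  by rewrite cg // !mxE; congr (_ * _); apply: eq_bigr => l _; rewrite mxE.
rewrite -(mcoeffMX _ (U_(i0) *+ N i0)%MM) -mpolyXn rg.
rewrite mulr_sumr.
under eq_bigr => j _ do
  rewrite mulrCA -[X in _ * X]mulrA detg mulrA mulr_sumr.
rewrite exchange_big raddf_sum big1 // => k kNi0.
under eq_bigr => j _ do rewrite mulrA.
rewrite -mulr_suml; apply: mcoeffMXn_lt.
rewrite mnmDE mulmnE mnm1E mnmE eq_sym (negPf kNi0) mul0n add0n.
by rewrite prednK.
Qed.

(** Rows of [c] are exchanged for rows of [c'] one at a time. The determinant is linear in each row,
    and the difference of two corresponding rows is a syzygy of [g], which contributes nothing by
    [residue_syzygy]. *)
Lemma residue_datum_uniq_exp f g N c c' :
  residue_datum g N c -> residue_datum g N c' ->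
  (f * \det c)@_(pred_mnm N) = (f * \det c')@_(pred_mnm N).
Proof.
move=> [N_gt0 cg] [_ c'g].
pose h s : 'M_n := \matrix_(i, j) if (i < s)%N then c' i j else c i j.
have hg s i : 'X_i ^+ N i = \sum_j h s i j * g j.
  by under eq_bigr do rewrite mxE; case: (i < s)%N.
suff step s : (s <= n)%N ->
    (f * \det (h s))@_(pred_mnm N) = (f * \det c)@_(pred_mnm N).
  rewrite -(step n) //; congr ((f * \det _)@_ _).
  by apply/matrixP => i j; rewrite mxE ltn_ord.
elim: s => [|s IHs] lt_sn.
  by congr ((f * \det _)@_ _); apply/matrixP => i j; rewrite mxE.
rewrite -(IHs (ltnW lt_sn)); pose i0 := Ordinal lt_sn.
pose e : 'M_n := \matrix_(i, j) if i == i0 then c' i j - c i j else h s i j.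
have neq_ltS i : lift i0 i != s :> nat.
  by have := neq_lift i0 i; rewrite eq_sym.
have -> : \det (h s.+1) = \det (h s) + \det e.
  rewrite -[\det (h s)]mul1r -[\det e]mul1r.
  apply: (@determinant_multilinear _ _ _ _ _ i0).
  - apply/rowP => j; rewrite !mxE eqxx ltnS leqnn ltnn.
    by rewrite !mul1r addrC subrK.
  - apply/matrixP => i j; rewrite !mxE ltnS (leq_eqVlt (lift i0 i) s).
    by rewrite (negPf (neq_ltS i)).
  - apply/matrixP => i j; rewrite !mxE eq_sym (negPf (neq_lift _ _)).
    by rewrite ltnS (leq_eqVlt (lift i0 i) s) (negPf (neq_ltS i)).
have e0 : (f * \det e)@_(pred_mnm N) = 0.
  apply: (@residue_syzygy f g N e i0 (c i0) N_gt0) => [i iNi0||].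
  - by rewrite (hg s); apply: eq_bigr => j _; rewrite [e i j]mxE (negPf iNi0).
  - under eq_bigr do rewrite mxE eqxx mulrBl.
    by rewrite sumrB -cg -c'g subrr.
  - exact: cg.
by rewrite mulrDr mcoeffD [X in _ + X = _]e0 addr0.
Qed.

Lemma residue_datumM g N N' c : residue_datum g N c ->
  residue_datum g (N + N')%MM (\matrix_(i, j) ('X_i ^+ N' i * c i j)).
Proof.
move=> [N_gt0 cg]; split=> i; first by rewrite mnmDE addn_gt0 N_gt0.
rewrite mnmDE addnC exprD cg mulr_sumr.
by apply: eq_bigr => j _; rewrite mxE mulrA.
Qed.

(** Scaling the rows multiplies the determinant by the monomial with exponent [N'], and the
    coefficient that is read off moves by exactly [N']. Positivity of [N] makes the truncated
    predecessor commute with this shift. *)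
Lemma residue_datum_shift f g N N' c : residue_datum g N c ->
  (f * \det (\matrix_(i, j) ('X_i ^+ N' i * c i j)))@_(pred_mnm (N + N')) =
  (f * \det c)@_(pred_mnm N).
Proof.
move=> [N_gt0 _].
have -> : (\matrix_(i, j) ('X_i ^+ N' i * c i j)) =
    diag_mx (\row_i 'X_i ^+ N' i) *m c.
  by apply/matrixP => i j; rewrite mul_diag_mx !mxE.
rewrite det_mulmx det_diag.
under eq_bigr do rewrite mxE.
rewrite -mpolyXE_id mulrCA mulrC -(mcoeffMX (f * \det c) N').
congr (_@_ _); apply/mnmP => i; rewrite mnmDE !mnmE.
by have := N_gt0 i; case: (N i : nat) => //= k _; rewrite addnC.
Qed.

(** Data with exponents [N1] and [N2] are both raised to [N1 + N2], where they can be compared. *)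
Lemma residueE f g N c : residue_datum g N c ->
  residue f g = (f * \det c)@_(pred_mnm N).
Proof.
move=> cg; apply: xget_subset1 => [|r1 r2]; first by case: cg; exists N, c.
move=> [N1 [c1 [N1_gt0 c1g ->]]] [N2 [c2 [N2_gt0 c2g ->]]].
have cg1 : residue_datum g N1 c1 by [].
have cg2 : residue_datum g N2 c2 by [].
rewrite -(residue_datum_shift f N2 cg1) -(residue_datum_shift f N1 cg2).
rewrite [X in pred_mnm X]addmC; apply: residue_datum_uniq_exp.
  by rewrite addmC; apply: residue_datumM.
exact: residue_datumM.
Qed.

End Residue.

(** * Koszul matrices in three variables *)

Definition ix : 'I_3 := @Ordinal 3 0 isT.
Definition iy : 'I_3 := @Ordinal 3 1 isT.
Definition iz : 'I_3 := @Ordinal 3 2 isT.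

Lemma ord3_cases (P : 'I_3 -> Prop) : P ix -> P iy -> P iz -> forall i, P i.
Proof.
move=> P0 P1 P2 [[|[|[|//]]] lti].
- by rewrite (_ : Ordinal lti = ix) //; apply: val_inj.
- by rewrite (_ : Ordinal lti = iy) //; apply: val_inj.
- by rewrite (_ : Ordinal lti = iz) //; apply: val_inj.
Qed.

Lemma big_ord3 (T : Type) (idx : T) (op : Monoid.law idx) (F : 'I_3 -> T) :
  \big[op/idx]_(i < 3) F i = op (op (F ix) (F iy)) (F iz).
Proof.
rewrite !big_ord_recl big_ord0 Monoid.mulm1 Monoid.mulmA.
by congr (op (op (F _) (F _)) (F _)); apply: val_inj.
Qed.

Lemma det3 (S : comNzRingType) (A : 'M[S]_3) : \det A =
  A ix ix * (A iy iy * A iz iz - A iy iz * A iz iy) -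
  A ix iy * (A iy ix * A iz iz - A iy iz * A iz ix) +
  A ix iz * (A iy ix * A iz iy - A iy iy * A iz ix).
Proof.
rewrite (expand_det_row _ ix) big_ord3 /cofactor.
rewrite !(expand_det_row _ ord0) !big_ord_recl !big_ord0 /cofactor !det_mx11.
(* Indexing by natural numbers makes the different terms for the same ordinal coincide, so that
   [ring] identifies the entries. *)
pose B k l := A (inord k) (inord l).
have AB i j : A i j = B i j by rewrite /B !inord_val.
rewrite !mxE !AB /=; ring.
Qed.

Section Koszul.
Variable S : comNzRingType.
Implicit Types (a b : 'I_3 -> S) (s t : seq (seq S)).

Definition seqmx4 s : 'M[S]_4 := \matrix_(i, j) nth 0 (nth [::] s i) j.

(** With lists of entries, products of explicit matrices are computed by reduction, and [ring] only
    meets expressions in the entries. *)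
Definition seqmul4 s t : seq (seq S) :=
  let e u i j := nth 0 (nth [::] u i) j in
  mkseq (fun i => mkseq (fun j =>
    e s i 0 * e t 0 j + e s i 1 * e t 1 j +
    e s i 2 * e t 2 j + e s i 3 * e t 3 j) 4) 4.

Lemma seqmx4M s t : seqmx4 s *m seqmx4 t = seqmx4 (seqmul4 s t).
Proof.
apply/matrixP => i j; rewrite !mxE !nth_mkseq //.
by rewrite !big_ord_recl big_ord0 !mxE addr0 !addrA.
Qed.

Lemma tr_seqmx4 s : let e i := nth 0 (nth [::] s i) i in
  \tr (seqmx4 s) = e 0 + e 1 + e 2 + e 3.
Proof. by rewrite /mxtrace !big_ord_recl big_ord0 !mxE addr0 !addrA. Qed.

(* The two blocks of \sum_i (a_i theta_i + b_i theta_i^* ) on the exterior algebra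
   of theta_x, theta_y, theta_z. They are built one pair at a time: the blocks A, B
   for the first pairs give [[a, A], [B, - b]] and [[b, A], [B, - a]]. *)
Definition koszul_ev a b := seqmx4
  [:: [:: a iz; 0;    a iy;   a ix  ];
      [:: 0;    a iz; b ix;   - b iy];
      [:: b iy; a ix; - b iz; 0     ];
      [:: b ix; - a iy; 0;    - b iz]].

Definition koszul_od a b := seqmx4
  [:: [:: b iz; 0;    a iy;   a ix  ];
      [:: 0;    b iz; b ix;   - b iy];
      [:: b iy; a ix; - a iz; 0     ];
      [:: b ix; - a iy; 0;    - a iz]].

Definition koszul_mx a b : 'M[S]_(4 + 4) :=
  block_mx 0 (koszul_ev a b) (koszul_od a b) 0.

Lemma koszul_mx_sq a b :
  koszul_mx a b *m koszul_mx a b = (\sum_i a i * b i)%:M.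
Proof.
rewrite mulmx_block !(mul0mx, mulmx0, add0r, addr0) (@scalar_mx_block _ 4 4).
rewrite big_ord3 !seqmx4M; congr (block_mx _ _ _ _).
  by apply/matrixP => -[[|[|[|[|//]]]] ?] [[|[|[|[|//]]]] ?];
    rewrite !mxE /=; ring.
by apply/matrixP => -[[|[|[|[|//]]]] ?] [[|[|[|[|//]]]] ?];
  rewrite !mxE /=; ring.
Qed.

Lemma prod3_koszul_mx (a b : 'I_3 -> 'I_3 -> S) :
  \prod_(i < 3) koszul_mx (a i) (b i) =
  block_mx 0
    (koszul_ev (a ix) (b ix) *m koszul_od (a iy) (b iy)
      *m koszul_ev (a iz) (b iz))
    (koszul_od (a ix) (b ix) *m koszul_ev (a iy) (b iy)
      *m koszul_od (a iz) (b iz)) 0.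
Proof.
rewrite big_ord3 /= -!mulmxE /koszul_mx.
by do 2!rewrite mulmx_block !(mul0mx, mulmx0, add0r, addr0).
Qed.

(* Up to sign, the supertrace of six Clifford vectors is the 6 x 6 determinant of
   their coordinates, here that of the block matrix [[-1, be], [J, et]]. *)
Lemma supertrace_koszul_mx (be J et : 'M[S]_3) :
  supertrace
    ((\prod_(i < 3) koszul_mx (fun j => - (i == j)%:R) (be i)) *
     \prod_(i < 3) koszul_mx (J i) (et i)) = \det (et + J *m be).
Proof.
rewrite (prod3_koszul_mx (fun i j => - (i == j)%:R)) prod3_koszul_mx -mulmxE.
rewrite mulmx_block !(mul0mx, mulmx0, add0r, addr0).
rewrite /supertrace block_mxKul block_mxKdr !seqmx4M !tr_seqmx4.
by rewrite det3 !mxE !big_ord3 /seqmul4 /=; ring.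
Qed.

End Koszul.

(** * Weighted homogeneous polynomials *)

Section WeightedHomogeneous.
Variables (K : comNzRingType) (n : nat) (w : n.-tuple rat).
Implicit Types (p : {mpoly K[n]}) (m : 'X_{1..n}) (q : rat).

Definition wdeg m : rat := \sum_(i < n) tnth w i * (m i)%:R.

(** A condition on coefficients rather than on substitutions: it makes sense over any ring, admits 0
    in every degree, and can be checked along the syntax of a polynomial. *)
Definition whomog q p := forall m, p@_m != 0 -> wdeg m = q.

Lemma wdegD m1 m2 : wdeg (m1 + m2)%MM = wdeg m1 + wdeg m2.
Proof.
by rewrite -big_split; apply: eq_bigr => i _ /=; rewrite mnmDE natrD mulrDr.
Qed.

Lemma wdegU i : wdeg U_(i)%MM = tnth w i.
Proof.
rewrite /wdeg (bigD1 i) //= mnm1E eqxx mulr1 big1 ?addr0 // => j jNi.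
by rewrite mnm1E eq_sym (negPf jNi) mulr0.
Qed.

Lemma wdeg0 : wdeg 0%MM = 0.
Proof. by rewrite /wdeg big1 // => i _; rewrite mnm0E mulr0. Qed.

Lemma whomog0 q : whomog q 0.
Proof. by move=> m; rewrite mcoeff0 eqxx. Qed.

Lemma whomogC c : whomog 0 c%:MP.
Proof.
move=> m; rewrite mcoeffC; case: (m =P 0%MM) => [-> _|_]; first exact: wdeg0.
by rewrite mulr0 eqxx.
Qed.

Lemma whomogX i : whomog (tnth w i) 'X_i.
Proof.
by move=> m; rewrite mcoeffX; case: (_ =P m) => [<- _|_]; rewrite ?wdegU ?eqxx.
Qed.

Lemma whomogD q p1 p2 : whomog q p1 -> whomog q p2 -> whomog q (p1 + p2).
Proof.
move=> h1 h2 m; rewrite mcoeffD.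
by have [p1m0|/h1 -> //] := eqVneq p1@_m 0; rewrite p1m0 add0r => /h2.
Qed.

Lemma whomogN q p : whomog q p -> whomog q (- p).
Proof. by move=> h m; rewrite mcoeffN oppr_eq0; apply: h. Qed.

Lemma whomogM q q1 q2 p1 p2 :
  whomog q1 p1 -> whomog q2 p2 -> q = q1 + q2 -> whomog q (p1 * p2).
Proof.
move=> h1 h2 -> m; rewrite -mcoeff_msupp => /msuppM_le /allpairsP[[m1 m2]] /=.
by rewrite !mcoeff_msupp => -[/h1 <- /h2 <- ->]; rewrite wdegD.
Qed.

Lemma whomogXn q q1 p k : whomog q1 p -> q = q1 * k%:R -> whomog q (p ^+ k).
Proof.
move=> h ->; elim: k => [|k IHk]; first by rewrite expr0 mulr0; apply: whomogC.
by rewrite exprS; apply: whomogM h IHk _; rewrite mulrS mulrDr mulr1.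
Qed.

Lemma whomog_sum q (I : finType) (F : I -> {mpoly K[n]}) :
  (forall i, whomog q (F i)) -> whomog q (\sum_i F i).
Proof.
by move=> h; apply: big_ind => //; [exact: whomog0 | exact: whomogD].
Qed.

Lemma whomog_mderiv q p k : whomog q p -> whomog (q - tnth w k) p^`M(k).
Proof.
move=> h m; rewrite mcoeff_mderiv => nz; rewrite -(h (m + U_(k))%MM).
  by rewrite wdegD wdegU addrK.
by apply: contraNneq nz => ->; rewrite mul0rn.
Qed.

Lemma whomog_eval0 q p : whomog q p -> q != 0 -> p.@[fun=> 0] = 0.
Proof.
move=> h q_neq0; rewrite mevalE big1_seq // => m /= pm.
have [i mi] : exists i, m i != 0%N.
  apply/existsP; apply: contraNT q_neq0 => /existsPn m0.
  rewrite -(h m) -?mcoeff_msupp // -wdeg0; apply/eqP; congr wdeg.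
  by apply/mnmP => i; rewrite mnm0E; apply/eqP; rewrite -[_ == _]negbK m0.
by rewrite (bigD1 i) //= expr0n (negPf mi) mul0r mulr0.
Qed.

Definition wpart q p : {mpoly K[n]} :=
  \sum_(m <- msupp p | wdeg m == q) p@_m *: 'X_[m].

Lemma mcoeff_wpart q p m : (wpart q p)@_m = if wdeg m == q then p@_m else 0.
Proof.
rewrite /wpart raddf_sum /=.
under eq_bigr do rewrite mcoeffZ mcoeffX mulr_natr.
have [pm|pm] := boolP (m \in msupp p); last first.
  rewrite big1_seq ?(memN_msupp_eq0 pm) ?if_same // => k /andP[_ pk].
  by case: eqP => // km; rewrite -km pk in pm.
rewrite big_mkcond /= (bigD1_seq m) //= eqxx mulr1n big1 ?addr0 // => k kNm.
by rewrite (negPf kNm) mulr0n if_same.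
Qed.

(** This is the free graded module whose basis vector number [i] is placed in degree [s i]. *)
Definition shift_grading r (s : 'I_r -> rat) q (v : 'cV[{mpoly K[n]}]_r) :=
  forall i, whomog (q - s i) (v i 0).

Lemma shift_gradingP r (s : 'I_r -> rat) : grading w (shift_grading s).
Proof.
split=> [q i|q u v hu hv i|q a v hv i|q k v hv i|v|l c l_uniq hc sum0 q lq].
- by rewrite mxE; apply: whomog0.
- by rewrite mxE; apply: whomogD.
- by rewrite mxE; apply: whomogM (@whomogC a) (hv i) _; rewrite add0r.
- by rewrite mxE; apply: whomogM (@whomogX k) (hv i) _; ring.
(* The finitely many degrees that occur are those of the monomials of each coordinate, shifted by
   the degree of its basis vector. *)
- pose l := undup [seq wdeg m + s i | i <- enum 'I_r, m <- msupp (v i 0)].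
  exists l, (fun q => \col_i wpart (q - s i) (v i 0)); split.
  + exact: undup_uniq.
  + move=> q i m; rewrite mxE mcoeff_wpart.
    by case: (eqVneq (wdeg m)) => // _; rewrite eqxx.
  apply/matrixP => i j; rewrite (ord1 j) summxE; apply/mpolyP => m.
  rewrite raddf_sum /=; under eq_bigr do rewrite mxE mcoeff_wpart.
  have [pm|pm] := eqVneq (v i 0)@_m 0.
    by rewrite big1 // pm => q; case: ifP.
  rewrite (bigD1_seq (wdeg m + s i)) /= ?undup_uniq //; last first.
    rewrite mem_undup; apply/allpairsPdep; exists i, m.
    by rewrite mem_enum mcoeff_msupp.
  rewrite addrK eqxx big1 ?addr0 // => q qN; case: eqP => // def_q.
  by rewrite def_q subrK eqxx in qN.
(* A monomial [m] in coordinate [i] can only come from the summand of degree [wdeg m + s i], so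
   distinct summands cannot cancel. *)
apply/matrixP => i j; rewrite (ord1 j) mxE; apply/mpolyP => m; rewrite mcoeff0.
apply/eqP; apply: contraT => cm; have def_q := hc _ _ _ cm.
move/matrixP/(_ i 0)/mpolyP/(_ m): sum0.
rewrite summxE raddf_sum mxE mcoeff0 (bigD1_seq q) //= big1 ?addr0.
  by move=> c0; rewrite c0 eqxx in cm.
move=> q' q'N; apply/eqP; apply: contraT => /hc; rewrite def_q.
by move/addIr => qq'; rewrite qq' eqxx in q'N.
Qed.

(** Column [j] is the image of a basis vector of degree [s j]; its coefficient at a basis vector of
    degree [t i] must make up the difference to [s j + 1]. *)
Lemma shift_grading_mulmx r r' (s : 'I_r -> rat) (t : 'I_r' -> rat)
    (D : 'M[{mpoly K[n]}]_(r', r)) :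
  (forall i j, whomog (s j + 1 - t i) (D i j)) ->
  forall q v, shift_grading s q v -> shift_grading t (q + 1) (D *m v).
Proof.
move=> hD q v hv i; rewrite mxE; apply: whomog_sum => j.
by apply: whomogM (hD i j) (hv j) _; ring.
Qed.

End WeightedHomogeneous.

(** As [pw] turns sums into products, the substitution scales a monomial [m] by [pw (wdeg m)], which
    is [pw 2 = pw 1 ^+ 2]. *)
Lemma whomog_homogeneous2 (R : realType) n (w : n.-tuple rat)
  (W : {mpoly R[i][n]}) : whomog w 2 W -> homogeneous2 w W.
Proof.
move=> hW pw [pw1 pwD].
have pw0 : pw 0 = 1.
  by apply: (mulfI pw1); rewrite -pwD addr0 mulr1.
have pwMn q k : pw (q * k%:R) = pw q ^+ k.
  elim: k => [|k IHk]; first by rewrite mulr0 expr0.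
  by rewrite mulrS mulrDr mulr1 pwD exprS IHk.
rewrite comp_mpolyE [in RHS](mpolyE W) scaler_sumr.
apply: eq_big_seq => m; rewrite mcoeff_msupp => /hW degm.
under eq_bigr do rewrite tnth_mktuple exprZn -mul_mpolyC.
rewrite big_split /= -mpolyXE_id -rmorph_prod /= mul_mpolyC scalerA.
rewrite scalerA mulrC; congr (_ * _ *: _).
rewrite -pwMn mul1r -degm.
by rewrite /wdeg (big_morph pw pwD pw0); apply: eq_bigr => i _; rewrite pwMn.
Qed.

(** * Polynomials in two sets of variables *)

Section MPolyMorphisms.
Variables (K : comNzRingType).

Lemma mpoly_alg_ind n (P : {mpoly K[n]} -> Prop) :
    (forall c, P c%:MP) -> (forall i, P 'X_i) ->
    (forall p q, P p -> P q -> P (p + q)) ->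
    (forall p q, P p -> P q -> P (p * q)) ->
  forall p, P p.
Proof.
move=> PC PX PD PM p; rewrite (mpolyE p); apply: (big_ind P (PC 0) PD) => m _.
rewrite -mul_mpolyC mpolyXE_id; apply: (PM) => //.
apply: (big_ind P (PC 1) PM) => i _.
elim: (m i) => [|k IHk]; first exact: (PC 1).
by rewrite exprS; apply: PM.
Qed.

Lemma mpoly_rmorphism_ext n (S : comNzRingType)
    (f g : {rmorphism {mpoly K[n]} -> S}) :
    (forall c, f c%:MP = g c%:MP) -> (forall i, f 'X_i = g 'X_i) ->
  f =1 g.
Proof.
move=> fgC fgX; apply: mpoly_alg_ind => // p q fgp fgq.
  by rewrite !rmorphD fgp fgq.
by rewrite !rmorphM fgp fgq.
Qed.

Lemma mderivXU n (i k : 'I_n) : ('X_i : {mpoly K[n]})^`M(k) = (i == k)%:R.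
Proof.
rewrite mderivX mnm1E; case: eqP => [->|_]; last by rewrite scale0r.
rewrite scale1r (_ : (U_(k) - U_(k))%MM = 0%MM) ?mpolyX0 //.
by apply/mnmP => j; rewrite mnmBE subnn mnm0E.
Qed.

Lemma mderiv_comp_mpoly n m (p : {mpoly K[n]}) (t : n.-tuple {mpoly K[m]}) k :
  (p \mPo t)^`M(k) = \sum_i (p^`M(i) \mPo t) * (tnth t i)^`M(k).
Proof.
elim/mpoly_alg_ind: p => [c|i|p q IHp IHq|p q IHp IHq].
- rewrite comp_mpolyC mderivC big1 // => i _.
  by rewrite mderivC comp_mpoly0 mul0r.
- rewrite comp_mpolyXU -tnth_nth (bigD1 i) //= mderivXU eqxx comp_mpoly1 mul1r.
  rewrite big1 ?addr0 // => j jNi; rewrite mderivXU eq_sym (negPf jNi).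
  by rewrite comp_mpoly0 mul0r.
- rewrite comp_mpolyD mderivD IHp IHq -big_split; apply: eq_bigr => i _ /=.
  by rewrite mderivD comp_mpolyD mulrDl.
rewrite rmorphM mderivM IHp IHq mulr_suml mulr_sumr -big_split.
by apply: eq_bigr => i _ /=; rewrite mderivM rmorphD !rmorphM; ring.
Qed.

Section TwoSets.
Variables m n : nat.

HB.instance Definition _ := GRing.RMorphism.copy (@inx K m n)
  (comp_mpoly [tuple 'X_(lshift n i) | i < m]).
HB.instance Definition _ := GRing.RMorphism.copy (@iny K m n)
  (comp_mpoly [tuple 'X_(rshift m j) | j < n]).
HB.instance Definition _ := GRing.RMorphism.copy (@to_Kx_y K m n)
  (mmap (@mpolyC n _ \o @mpolyC m K)
       (fun k => match split k with
                 | inl i => ('X_i)%:MP_[n]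
                 | inr j => 'X_j
                 end)).
HB.instance Definition _ := GRing.RMorphism.copy (@to_Ky_x K m n)
  (mmap (@mpolyC m _ \o @mpolyC n K)
       (fun k => match split k with
                 | inl i => 'X_i
                 | inr j => ('X_j)%:MP_[m]
                 end)).

Lemma inxC c : inx n (c%:MP_[m] : {mpoly K[m]}) = c%:MP.
Proof. exact: comp_mpolyC. Qed.
Lemma inyC c : iny m (c%:MP_[n] : {mpoly K[n]}) = c%:MP.
Proof. exact: comp_mpolyC. Qed.
Lemma inxD : {morph @inx K m n : p q / p + q}. Proof. exact: rmorphD. Qed.
Lemma inyD : {morph @iny K m n : p q / p + q}. Proof. exact: rmorphD. Qed.
Lemma inxM : {morph @inx K m n : p q / p * q}. Proof. exact: rmorphM. Qed.
Lemma inyM : {morph @iny K m n : p q / p * q}. Proof. exact: rmorphM. Qed.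
Lemma inxXn k : {morph @inx K m n : p / p ^+ k}. Proof. exact: rmorphXn. Qed.
Lemma inyXn k : {morph @iny K m n : p / p ^+ k}. Proof. exact: rmorphXn. Qed.
Lemma inxX i : inx n ('X_i : {mpoly K[m]}) = 'X_(lshift n i).
Proof. by rewrite /inx comp_mpolyXU -tnth_nth tnth_mktuple. Qed.
Lemma inyX j : iny m ('X_j : {mpoly K[n]}) = 'X_(rshift m j).
Proof. by rewrite /iny comp_mpolyXU -tnth_nth tnth_mktuple. Qed.

Lemma to_Kx_yC c : to_Kx_y (c%:MP_[m + n] : {mpoly K[m + n]}) = c%:MP%:MP.
Proof. exact: (mmapC _ (@mpolyC n _ \o @mpolyC m K)). Qed.
Lemma to_Ky_xC c : to_Ky_x (c%:MP_[m + n] : {mpoly K[m + n]}) = c%:MP%:MP.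
Proof. exact: (mmapC _ (@mpolyC m _ \o @mpolyC n K)). Qed.
Lemma to_Kx_yX k : to_Kx_y ('X_k : {mpoly K[m + n]}) =
  match split k with inl i => ('X_i)%:MP_[n] | inr j => 'X_j end.
Proof.
exact: etrans (mmapX _ (@mpolyC n _ \o @mpolyC m K) _) (mmap1U _ k).
Qed.
Lemma to_Ky_xX k : to_Ky_x ('X_k : {mpoly K[m + n]}) =
  match split k with inl i => 'X_i | inr j => ('X_j)%:MP_[m] end.
Proof.
exact: etrans (mmapX _ (@mpolyC m _ \o @mpolyC n K) _) (mmap1U _ k).
Qed.
Lemma to_Kx_yl i : to_Kx_y ('X_(lshift n i) : {mpoly K[m + n]}) = ('X_i)%:MP.
Proof. by rewrite to_Kx_yX (unsplitK (inl i)). Qed.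
Lemma to_Kx_yr j : to_Kx_y ('X_(rshift m j) : {mpoly K[m + n]}) = 'X_j.
Proof. by rewrite to_Kx_yX (unsplitK (inr j)). Qed.
Lemma to_Ky_xl i : to_Ky_x ('X_(lshift n i) : {mpoly K[m + n]}) = 'X_i.
Proof. by rewrite to_Ky_xX (unsplitK (inl i)). Qed.
Lemma to_Ky_xr j : to_Ky_x ('X_(rshift m j) : {mpoly K[m + n]}) = ('X_j)%:MP.
Proof. by rewrite to_Ky_xX (unsplitK (inr j)). Qed.

Lemma to_Kx_y_iny (p : {mpoly K[n]}) :
  to_Kx_y (iny m p) = map_mpoly (@mpolyC m K) p.
Proof.
apply: (mpoly_rmorphism_ext (f := @to_Kx_y K m n \o @iny K m n)
  (g := map_mpoly (@mpolyC m K))) => [c|j] /=.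
  by rewrite inyC to_Kx_yC map_mpolyC.
by rewrite inyX to_Kx_yr map_mpolyX.
Qed.

Lemma to_Ky_x_inx (p : {mpoly K[m]}) :
  to_Ky_x (inx n p) = map_mpoly (@mpolyC n K) p.
Proof.
apply: (mpoly_rmorphism_ext (f := @to_Ky_x K m n \o @inx K m n)
  (g := map_mpoly (@mpolyC n K))) => [c|i] /=.
  by rewrite inxC to_Ky_xC map_mpolyC.
by rewrite inxX to_Ky_xl map_mpolyX.
Qed.

(** Setting x = 0 passes through K[x][y], so that it is literally the coefficientwise evaluation
    produced by [residue_eval0]. *)
Definition evx0 (p : {mpoly K[m + n]}) : {mpoly K[n]} :=
  map_mpoly (meval (fun=> 0)) (to_Kx_y p).
Definition evy0 (p : {mpoly K[m + n]}) : {mpoly K[m]} :=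
  map_mpoly (meval (fun=> 0)) (to_Ky_x p).
HB.instance Definition _ := GRing.RMorphism.copy evx0
  (map_mpoly (meval (fun=> 0)) \o @to_Kx_y K m n).
HB.instance Definition _ := GRing.RMorphism.copy evy0
  (map_mpoly (meval (fun=> 0)) \o @to_Ky_x K m n).

Lemma evx0l i : evx0 'X_(lshift n i) = 0.
Proof. by rewrite /evx0 to_Kx_yl map_mpolyC /= mevalXU mpolyC0. Qed.
Lemma evx0r j : evx0 'X_(rshift m j) = 'X_j.
Proof. by rewrite /evx0 to_Kx_yr map_mpolyX. Qed.
Lemma evx0C c : evx0 c%:MP = c%:MP.
Proof. by rewrite /evx0 to_Kx_yC map_mpolyC /= mevalC. Qed.
Lemma evy0l i : evy0 'X_(lshift n i) = 'X_i.
Proof. by rewrite /evy0 to_Ky_xl map_mpolyX. Qed.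
Lemma evy0r j : evy0 'X_(rshift m j) = 0.
Proof. by rewrite /evy0 to_Ky_xr map_mpolyC /= mevalXU mpolyC0. Qed.
Lemma evy0C c : evy0 c%:MP = c%:MP.
Proof. by rewrite /evy0 to_Ky_xC map_mpolyC /= mevalC. Qed.

Lemma evx0_iny p : evx0 (iny m p) = p.
Proof.
apply: (mpoly_rmorphism_ext (f := evx0 \o @iny K m n) (g := idfun)) => [c|j] /=.
  by rewrite inyC evx0C.
by rewrite inyX evx0r.
Qed.
Lemma evx0_inx p : evx0 (inx n p) = p.@[fun=> 0]%:MP.
Proof.
apply: (mpoly_rmorphism_ext (f := evx0 \o @inx K m n)
  (g := @mpolyC n K \o meval (fun=> 0))) => [c|i] /=.
  by rewrite inxC evx0C mevalC.
by rewrite inxX evx0l mevalXU mpolyC0.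
Qed.
Lemma evy0_inx p : evy0 (inx n p) = p.
Proof.
apply: (mpoly_rmorphism_ext (f := evy0 \o @inx K m n) (g := idfun)) => [c|j] /=.
  by rewrite inxC evy0C.
by rewrite inxX evy0l.
Qed.
Lemma evy0_iny p : evy0 (iny m p) = p.@[fun=> 0]%:MP.
Proof.
apply: (mpoly_rmorphism_ext (f := evy0 \o @iny K m n)
  (g := @mpolyC m K \o meval (fun=> 0))) => [c|i] /=.
  by rewrite inyC evy0C mevalC.
by rewrite inyX evy0r mevalXU mpolyC0.
Qed.

Lemma mderiv_inx_l k (p : {mpoly K[m]}) :
  (inx n p)^`M(lshift n k) = inx n p^`M(k).
Proof.
rewrite mderiv_comp_mpoly (bigD1 k) //= tnth_mktuple mderivXU eqxx mulr1.
rewrite big1 ?addr0 // => i iNk.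
by rewrite tnth_mktuple mderivXU (inj_eq (@lshift_inj _ _)) (negPf iNk) mulr0.
Qed.
Lemma mderiv_inx_r k (p : {mpoly K[m]}) : (inx n p)^`M(rshift m k) = 0.
Proof.
rewrite mderiv_comp_mpoly big1 // => i _.
by rewrite tnth_mktuple mderivXU eq_lrshift mulr0.
Qed.
Lemma mderiv_iny_r k (p : {mpoly K[n]}) :
  (iny m p)^`M(rshift m k) = iny m p^`M(k).
Proof.
rewrite mderiv_comp_mpoly (bigD1 k) //= tnth_mktuple mderivXU eqxx mulr1.
rewrite big1 ?addr0 // => i iNk.
by rewrite tnth_mktuple mderivXU (inj_eq (@rshift_inj _ _)) (negPf iNk) mulr0.
Qed.
Lemma mderiv_iny_l k (p : {mpoly K[n]}) : (iny m p)^`M(lshift n k) = 0.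
Proof.
rewrite mderiv_comp_mpoly big1 // => i _.
by rewrite tnth_mktuple mderivXU eq_rlshift mulr0.
Qed.

End TwoSets.

(** The coefficients of [g] are constants, so one datum over [K] computes both residues, and
    evaluation at 0 affects [f] alone. *)
Lemma residue_eval0 m n (f : {mpoly {mpoly K[m]}[n]}) g N c :
  residue_datum g N c ->
  (residue f (fun j => map_mpoly (@mpolyC m K) (g j))).@[fun=> 0] =
  residue (map_mpoly (meval (fun=> 0)) f) g.
Proof.
move=> cg; rewrite (residueE _ cg).
have cg' : residue_datum (fun j => map_mpoly (@mpolyC m K) (g j)) N
    (map_mx (map_mpoly (@mpolyC m K)) c).
  case: cg => N_gt0 cg; split=> // i.
  rewrite -(map_mpolyX (@mpolyC m K)) -rmorphXn cg.
  by rewrite rmorph_sum; apply: eq_bigr => j _; rewrite mxE rmorphM.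
rewrite (residueE _ cg') -mcoeff_map_mpoly rmorphM -det_map_mx.
congr ((_ * \det _)@_ _); apply/matrixP => i j; rewrite !mxE.
apply/mpolyP => k; rewrite !mcoeff_map_mpoly.
exact: mevalC.
Qed.

(** The transformation law: if [c] expresses powers of the variables through [g], then [c *m D]
    expresses them through [h], and determinants multiply. *)
Lemma residue_change n (g h : 'I_n -> {mpoly K[n]}) N c (D : 'M_n) f :
  residue_datum g N c -> (forall i, g i = \sum_j D i j * h j) ->
  residue (\det D * f) g = residue f h.
Proof.
move=> cg gh.
have ch : residue_datum h N (c *m D).
  case: cg => N_gt0 cg; split=> // i; rewrite cg.
  under [RHS]eq_bigr do rewrite mxE mulr_suml.
  rewrite exchange_big; apply: eq_bigr => j _; rewrite gh mulr_sumr.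
  by apply: eq_bigr => k _; rewrite mulrA.
rewrite (residueE _ cg) (residueE _ ch) det_mulmx; congr (_@_ _).
by rewrite mulrAC mulrC [\det D * _]mulrC.
Qed.

End MPolyMorphisms.

(** * Quantum dimensions of a coordinate change *)

Lemma koszul_mx_odd (S : comNzRingType) (a b : 'I_3 -> S) :
  ulsubmx (koszul_mx a b) = 0 /\ drsubmx (koszul_mx a b) = 0.
Proof. by rewrite block_mxKul block_mxKdr. Qed.

Lemma koszul_mf_sq (S : comNzRingType) (F : S) (a b : 'I_3 -> S) :
  F = \sum_i a i * b i -> koszul_mx a b *m koszul_mx a b = F%:M.
Proof. by move=> ->; apply: koszul_mx_sq. Qed.

Definition koszul_mf (S : comNzRingType) (F : S) (a b : 'I_3 -> S)
    (Fab : F = \sum_i a i * b i) : matrix_factorization F :=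
  @MatrixFactorization _ F 4 4 (koszul_mx a b) (koszul_mx_odd a b)
    (koszul_mf_sq Fab).

Lemma mderiv_koszul_mx (K : comNzRingType) n k (a b : 'I_3 -> {mpoly K[n]}) :
  map_mx (mderiv k) (koszul_mx a b) =
  koszul_mx (fun i => (a i)^`M(k)) (fun i => (b i)^`M(k)).
Proof.
rewrite /koszul_mx map_block_mx !map_mx0; congr (block_mx _ _ _ _).
  by apply/matrixP => -[[|[|[|[|//]]]] ?] [[|[|[|[|//]]]] ?];
    rewrite !mxE /= ?mderiv0 ?mderivN.
by apply/matrixP => -[[|[|[|[|//]]]] ?] [[|[|[|[|//]]]] ?];
  rewrite !mxE /= ?mderiv0 ?mderivN.
Qed.

Lemma meval0_mcoeff (K : comNzRingType) n (p : {mpoly K[n]}) :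
  p.@[fun=> 0] = p@_0.
Proof.
have [M0 M1] := @mcoeff0_is_multiplicative n K.
elim/mpoly_alg_ind: p => [c|i|p q IHp IHq|p q IHp IHq].
- by rewrite mevalC mcoeffC eqxx mulr1.
- rewrite mevalXU mcoeffX; case: eqP => // /(congr1 (fun m : 'X_{1..n} => m i)).
  by rewrite mnm1E eqxx mnm0E.
- by rewrite mevalD mcoeffD IHp IHq.
by rewrite mevalM M0 IHp IHq.
Qed.

Lemma mderiv_sum_ord (K : comNzRingType) n r k (F : 'I_r -> {mpoly K[n]}) :
  (\sum_i F i)^`M(k) = \sum_i (F i)^`M(k).
Proof. exact: raddf_sum. Qed.

Section CoordinateChange.
Variables (K : fieldType) (V W : {mpoly K[3]}) (phi : 'I_3 -> {mpoly K[3]}).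
Variables (b : 'I_3 -> {mpoly K[3 + 3]}) (ga : 'M[{mpoly K[3]}]_3).
Variables (NV NW : 'X_{1..3}) (cV cW : 'M[{mpoly K[3]}]_3).

Let a i : {mpoly K[3 + 3]} := iny 3 (phi i) - 'X_(lshift 3 i).

Hypothesis Fab : iny 3 W - inx 3 V = \sum_i a i * b i.
Hypothesis gaP : forall i, 'X_i = \sum_j ga i j * phi j.
Hypothesis phi0 : forall i, (phi i).@[fun=> 0] = 0.
Hypothesis dV0 : forall i, V^`M(i).@[fun=> 0] = 0.
Hypothesis dW0 : forall i, W^`M(i).@[fun=> 0] = 0.
Hypothesis cVP : residue_datum (fun i => V^`M(i)) NV cV.
Hypothesis cWP : residue_datum (fun i => W^`M(i)) NW cW.

Let be : 'M_3 := \matrix_(i, j) (b j)^`M(lshift 3 i).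
Let et : 'M_3 := \matrix_(i, j) (b j)^`M(rshift 3 i).
Let J : 'M_3 := \matrix_(i, j) iny 3 (phi j)^`M(i).
Let M := koszul_mf Fab.

(** The derivative of [a j] is [- (i == j)%:R] along x number [i] and [J i j] along y number [i]:
    these are the vectors of [supertrace_koszul_mx]. *)
Lemma koszul_str_derivatives : str_derivatives M = \det (et + J *m be).
Proof.
rewrite /str_derivatives -supertrace_koszul_mx; congr supertrace.
rewrite big_split_ord /=; congr (_ * _); apply: eq_bigr => i _.
  rewrite mderiv_koszul_mx; congr koszul_mx; apply: funext => j.
    by rewrite mderivB mderiv_iny_l mderivXU (inj_eq (@lshift_inj _ _)) eq_sym
      sub0r.
  by rewrite mxE.
rewrite mderiv_koszul_mx; congr koszul_mx; apply: funext => j.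
  by rewrite mderivB mderiv_iny_r mderivXU eq_lrshift subr0 mxE.
by rewrite mxE.
Qed.

Lemma mderiv_koszul_l k :
  inx 3 V^`M(k) = b k - \sum_i be k i * a i.
Proof.
have := congr1 (mderiv (lshift 3 k)) Fab.
rewrite mderivB mderiv_iny_l mderiv_inx_l sub0r mderiv_sum_ord.
under eq_bigr do rewrite mderivM mderivB mderiv_iny_l mderivXU
  (inj_eq (@lshift_inj _ _)) sub0r.
rewrite big_split /= (bigD1 k) //= eqxx [X in _ + X + _]big1 => [|i iNk].
  rewrite addr0 mulN1r => /eqP; rewrite eqr_oppLR => /eqP ->.
  rewrite opprD opprK; congr (_ - _); apply: eq_bigr => i _.
  by rewrite mxE mulrC.
by rewrite (negPf iNk) oppr0 mul0r.
Qed.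

Lemma mderiv_koszul_r k :
  iny 3 W^`M(k) = \sum_i J k i * b i + \sum_i et k i * a i.
Proof.
have := congr1 (mderiv (rshift 3 k)) Fab.
rewrite mderivB mderiv_iny_r mderiv_inx_r subr0 mderiv_sum_ord => ->.
rewrite -big_split; apply: eq_bigr => i _ /=.
rewrite mderivM mderivB mderiv_iny_r mderivXU eq_lrshift subr0 !mxE.
by rewrite [_ * a i]mulrC.
Qed.

Let ga0 : 'M[K]_3 := map_mx (meval (fun=> 0)) ga.
Let J0 : 'M[K]_3 := \matrix_(i, j) (phi j)^`M(i).@[fun=> 0].

(** Differentiate [gaP] at 0: as [phi] vanishes there, only the terms in which [phi] is
    differentiated remain. *)
Lemma jacobian_inverse : J0 *m ga0^T = 1%:M.
Proof.
apply/matrixP => i k; rewrite !mxE.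
have := congr1 (fun p => p^`M(i).@[fun=> 0]) (gaP k).
rewrite mderivXU eq_sym rmorph_nat mderiv_sum_ord raddf_sum => ->.
apply: eq_bigr => j _; rewrite !mxE /= mderivM mevalD !mevalM phi0 mulr0 add0r.
by rewrite mulrC.
Qed.

Lemma det_ga0_neq0 : \det ga0 != 0.
Proof.
apply: contraTneq (oner_neq0 K) => ga0_eq0; rewrite negbK.
by rewrite -(det1 K 3) -jacobian_inverse det_mulmx det_tr ga0_eq0 mulr0.
Qed.

Lemma koszul_jacobianE k j :
  (et + J *m be) k j = et k j + \sum_i J k i * be i j.
Proof. by rewrite mxE; congr (_ + _); rewrite mxE. Qed.

(* As dV vanishes at 0, the x-derivatives of [Fab] express [b] on x = 0 through
   [phi]; substitute this in the y-derivatives. *)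
Lemma mderiv_evx0 k :
  W^`M(k) = \sum_j (map_mx (@evx0 K 3 3) (et + J *m be)) k j * phi j.
Proof.
have bE i : evx0 (b i) = \sum_j evx0 (be i j) * phi j.
  have := congr1 (@evx0 K 3 3) (mderiv_koszul_l i).
  rewrite evx0_inx dV0 mpolyC0 rmorphB rmorph_sum => /esym/eqP.
  rewrite subr_eq0 => /eqP ->; apply: eq_bigr => j _.
  by rewrite rmorphM rmorphB /= evx0_iny evx0l subr0.
have := congr1 (@evx0 K 3 3) (mderiv_koszul_r k).
rewrite evx0_iny => ->; rewrite rmorphD !rmorph_sum /= addrC.
under [X in _ + X]eq_bigr do rewrite rmorphM /= bE mulr_sumr.
rewrite exchange_big -big_split; apply: eq_bigr => j _ /=.
rewrite rmorphM rmorphB /= evx0_iny evx0l subr0 [in RHS]mxE koszul_jacobianE.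
rewrite [evx0 (_ + _)]rmorphD [RHS]mulrDl /=; congr (_ + _).
rewrite [evx0 _]rmorph_sum [RHS]mulr_suml; apply: eq_bigr => i _ /=.
by rewrite [evx0 (_ * _)]rmorphM mulrA.
Qed.

(** At y = 0 one has a = - x. The x-derivatives of [Fab] give dV = b + be x; the y-derivatives give
    J0 b = et x, because dW vanishes at 0. Multiplying the latter by [ga0^T], the inverse of [J0],
    eliminates b. *)
Lemma mderiv_evy0 k :
  V^`M(k) = \sum_j (map_mx (@mpolyC 3 K) ga0^T *m
                     map_mx (@evy0 K 3 3) (et + J *m be)) k j * 'X_j.
Proof.
have evy0_a i : evy0 (a i) = - 'X_i.
  by rewrite rmorphB /= evy0_iny phi0 evy0l mpolyC0 sub0r.
pose B : 'cV[{mpoly K[3]}]_3 := \col_i evy0 (b i).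
pose X : 'cV[{mpoly K[3]}]_3 := \col_i 'X_i.
have VB : \col_i V^`M(i) = B + map_mx (@evy0 K 3 3) be *m X.
  apply/matrixP => i j; have := congr1 (@evy0 K 3 3) (mderiv_koszul_l i).
  rewrite evy0_inx rmorphB rmorph_sum => e; rewrite [LHS]mxE {}e /=.
  rewrite -sumrN [RHS]mxE [B _ _]mxE; congr (_ + _).
  rewrite mxE; apply: eq_bigr => l _.
  by rewrite rmorphM /= evy0_a mulrN opprK [map_mx _ _ _ _]mxE [X _ _]mxE.
have JB : map_mx (@mpolyC 3 K) J0 *m B = map_mx (@evy0 K 3 3) et *m X.
  apply/matrixP => i j; have := congr1 (@evy0 K 3 3) (mderiv_koszul_r i).
  rewrite evy0_iny dW0 mpolyC0 rmorphD !rmorph_sum => /esym/eqP.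
  rewrite addr_eq0 -sumrN => /eqP /=.
  under eq_bigr => l _ do
    rewrite rmorphM [J _ _]mxE /= evy0_iny.
  move=> e; rewrite mxE; under eq_bigr do rewrite !mxE.
  rewrite {}e mxE; apply: eq_bigr => l _.
  by rewrite rmorphM /= evy0_a mulrN opprK [map_mx _ _ _ _]mxE [X _ _]mxE.
have gaJ : map_mx (@mpolyC 3 K) ga0^T *m map_mx (@mpolyC 3 K) J0 = 1%:M.
  by rewrite -map_mxM (mulmx1C jacobian_inverse) map_mx1.
have J0E : map_mx (@evy0 K 3 3) J = map_mx (@mpolyC 3 K) J0.
  by apply/matrixP => i j; rewrite !mxE evy0_iny.
transitivity ((\col_i V^`M(i)) k 0); first by rewrite mxE.
transitivity ((map_mx (@mpolyC 3 K) ga0^T *m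
    map_mx (@evy0 K 3 3) (et + J *m be) *m X) k 0); last first.
  by rewrite mxE; apply: eq_bigr => j _; rewrite [X _ _]mxE.
congr (fun_of_matrix _ k 0).
rewrite VB map_mxD map_mxM J0E; move: gaJ JB.
move: (map_mx _ ga0^T) (map_mx _ J0) (map_mx _ et) (map_mx _ be) => G J' E' B'.
by move=> GJ JB; rewrite mulmxDr mulmxDl -mulmxA -JB !mulmxA GJ !mul1mx.
Qed.

(** By [gaP] all exponents can be taken to be 1, so the residue is the constant coefficient of
    [\det ga]. *)
Lemma residue1_phi : residue 1 phi = \det ga0.
Proof.
have gaP' : residue_datum phi [multinom 1 | i < 3] ga.
  by split=> i; rewrite mnmE // expr1 gaP.
rewrite (residueE _ gaP') mul1r det_map_mx (_ : pred_mnm _ = 0%MM).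
  by rewrite /= meval0_mcoeff.
by apply/mnmP => i; rewrite mnm0E !mnmE.
Qed.

Lemma koszul_qdiml : qdiml M != 0.
Proof.
suff: (qdiml M).@[fun=> 0] != 0 by apply: contraNneq => ->; rewrite meval0.
rewrite rmorphM mulf_neq0 //=; first by rewrite rmorphXn rmorphN1 signr_eq0.
under [X in residue _ X]eq_fun do rewrite to_Kx_y_iny.
rewrite (residue_eval0 _ cWP) -/(evx0 _) koszul_str_derivatives.
rewrite -det_map_mx -[\det _]mulr1 (residue_change _ cWP mderiv_evx0).
by rewrite residue1_phi det_ga0_neq0.
Qed.

Lemma residue1_vars : residue 1 (fun i : 'I_3 => 'X_i : {mpoly K[3]}) = 1.
Proof.
have dX : residue_datum (fun i : 'I_3 => 'X_i : {mpoly K[3]})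
    [multinom 1 | i < 3] 1%:M.
  split=> i; rewrite mnmE // expr1 (bigD1 i) //= mxE eqxx mul1r big1 ?addr0 //.
  by move=> j jNi; rewrite mxE eq_sym (negPf jNi) mul0r.
rewrite (residueE _ dX) mul1r det1 (_ : pred_mnm _ = 0%MM).
  by rewrite -meval0_mcoeff meval1.
by apply/mnmP => i; rewrite mnm0E !mnmE.
Qed.

Lemma koszul_qdimr : qdimr M != 0.
Proof.
suff: (qdimr M).@[fun=> 0] != 0 by apply: contraNneq => ->; rewrite meval0.
rewrite rmorphM mulf_neq0 //=; first by rewrite rmorphXn rmorphN1 signr_eq0.
under [X in residue _ X]eq_fun do rewrite to_Ky_x_inx.
rewrite (residue_eval0 _ cVP) -/(evy0 _) koszul_str_derivatives.
(* The constant [\det ga0^T] times the wanted residue equals Res [1 / x] = 1, so neither factor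
   vanishes. *)
have := residue_change 1 cVP mderiv_evy0.
rewrite residue1_vars mulr1 det_mulmx det_map_mx (residueE _ cVP) -mulrA.
rewrite mcoeffCM -(residueE _ cVP) det_map_mx => e.
by apply: contraTneq (oner_neq0 K) => e0; rewrite negbK -e e0 mulr0.
Qed.
End CoordinateChange.

(** * Grading of the Koszul factorization *)

Section Grading.
Variable K : comNzRingType.

Lemma koszul_graded n (w : n.-tuple rat) (F : {mpoly K[n]})
    (a b : 'I_3 -> {mpoly K[n]}) (Fab : F = \sum_i a i * b i)
    (d : 'I_3 -> rat) :
  (forall i, whomog w (d i) (a i)) -> (forall i, whomog w (2 - d i) (b i)) ->
  graded_mf w (koszul_mf Fab).
Proof.
(* [s] and [t] are the degrees of the basis 1, xy, yz, xz of the even part and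
   z, xyz, y, x of the odd part of the exterior algebra, theta_i having degree
   [e i]. *)
move=> ha hb; pose e i := d i - 1.
pose s : 'I_4 -> rat :=
  nth 0 [:: 0; e ix + e iy; e iy + e iz; e ix + e iz].
pose t : 'I_4 -> rat := nth 0 [:: e iz; e ix + e iy + e iz; e iy; e ix].
have hab q1 q2 p : whomog w q1 p -> q1 = q2 -> whomog w q2 p by move=> ? <-.
exists (shift_grading w s), (shift_grading w t).
split; [exact: shift_gradingP | exact: shift_gradingP | |].
  rewrite /= block_mxKdl; apply: shift_grading_mulmx.
  by case=> -[|[|[|[|//]]]] ?; case=> -[|[|[|[|//]]]] ?; rewrite mxE /=;
    (try exact: whomog0); rewrite /s /t /e /=; try apply: whomogN;
    (apply: hab (ha _) _ || apply: hab (hb _) _); ring.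
rewrite /= block_mxKur; apply: shift_grading_mulmx.
by case=> -[|[|[|[|//]]]] ?; case=> -[|[|[|[|//]]]] ?; rewrite mxE /=;
  (try exact: whomog0); rewrite /s /t /e /=; try apply: whomogN;
  (apply: hab (ha _) _ || apply: hab (hb _) _); ring.
Qed.

Lemma whomog_comp m n (w : m.-tuple rat) (w' : n.-tuple rat) q
    (p : {mpoly K[m]}) (t : m.-tuple {mpoly K[n]}) :
  (forall i, whomog w' (tnth w i) (tnth t i)) -> whomog w q p ->
  whomog w' q (p \mPo t).
Proof.
move=> ht hp; rewrite comp_mpolyE big_seq.
apply: (big_ind (whomog w' q) (@whomog0 _ _ _ _) (@whomogD _ _ _ _)) => k.
rewrite mcoeff_msupp => /hp <-; rewrite -mul_mpolyC.
apply: whomogM (@whomogC _ _ _ _) _ (esym (add0r _)).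
rewrite /wdeg; elim/big_rec2: _ => [|i q' p' _ hp'].
  exact: (@whomogC _ _ _ 1).
by apply: whomogM hp' _ => //; apply: whomogXn (ht i) _.
Qed.

Variables (m n : nat) (w : m.-tuple rat) (w' : n.-tuple rat).

Lemma whomog_inx q (p : {mpoly K[m]}) :
  whomog w q p -> whomog [tuple of w ++ w'] q (inx n p).
Proof.
apply: whomog_comp => i; rewrite tnth_mktuple.
by have := @whomogX K _ [tuple of w ++ w'] (lshift n i); rewrite tnth_lshift.
Qed.

Lemma whomog_iny q (p : {mpoly K[n]}) :
  whomog w' q p -> whomog [tuple of w ++ w'] q (iny m p).
Proof.
apply: whomog_comp => i; rewrite tnth_mktuple.
by have := @whomogX K _ [tuple of w ++ w'] (rshift m i); rewrite tnth_rshift.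
Qed.
End Grading.

(** * Criterion for a graded coordinate change *)

Section Criterion.
Variable C : fieldType.

(* The factor [c] only serves to clear denominators. *)
Definition ideal_multiple n (g : 'I_n -> {mpoly C[n]}) (p : {mpoly C[n]}) :=
  exists (c : C) (r : 'I_n -> {mpoly C[n]}),
    c != 0 /\ c%:MP * p = \sum_j r j * g j.

Lemma ideal_multipleP n (g : 'I_n -> {mpoly C[n]}) p :
  ideal_multiple g p -> exists r : 'I_n -> {mpoly C[n]}, p = \sum_j r j * g j.
Proof.
move=> [c [r [c_neq0 cp]]]; exists (fun j => (c^-1)%:MP * r j).
under eq_bigr do rewrite -mulrA.
by rewrite -mulr_sumr -cp mulrA -mpolyCM mulVf // mul1r.
Qed.

(** One certificate with two uses: it is a row of a residue datum for the partial derivatives, and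
    it forces coordinate [i] of every critical point to be 0. *)
Definition power_in_jacobian (W : {mpoly C[3]}) i :=
  exists2 k, (0 < k)%N & ideal_multiple (fun j => W^`M(j)) ('X_i ^+ k).

Lemma power_in_jacobian_datum (W : {mpoly C[3]}) :
  (forall i, power_in_jacobian W i) ->
  exists N c, residue_datum (fun j => W^`M(j)) N c.
Proof.
move=> hW.
have /fin_all_exists[N /fin_all_exists[c cN]] (i : 'I_3) :
    exists k (r : 'I_3 -> {mpoly C[3]}),
      (0 < k)%N /\ 'X_i ^+ k = \sum_j r j * W^`M(j).
  by have [k k_gt0 /ideal_multipleP[r ?]] := hW i; exists k, r.
exists [multinom N i | i < 3], (\matrix_(i, j) c i j); split=> i.
  by rewrite mnmE; have [] := cN i.
by rewrite mnmE; have [_ ->] := cN i; apply: eq_bigr => j _; rewrite mxE.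
Qed.

Definition orbifold_mf (w : 3.-tuple rat) (V W : {mpoly C[3]}) :=
  exists M : matrix_factorization (iny 3 W - inx 3 V),
    [/\ graded_mf [tuple of w ++ w] M, qdiml M != 0 & qdimr M != 0].

(** Weights strictly between 0 and 2 give [phi i] and all partial derivatives nonzero degree, hence
    value 0 at the origin. *)
Lemma coordinate_change_mf (w : 3.-tuple rat)
    (V W : {mpoly C[3]}) (phi : 'I_3 -> {mpoly C[3]})
    (b : 'I_3 -> {mpoly C[3 + 3]}) :
  (forall i, 0 < tnth w i < 2) -> whomog w 2 V -> whomog w 2 W ->
  (forall i, whomog w (tnth w i) (phi i)) ->
  (forall i, whomog [tuple of w ++ w] (2 - tnth w i) (b i)) ->
  iny 3 W - inx 3 V = \sum_i (iny 3 (phi i) - inx 3 'X_i) * b i ->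
  (forall i, ideal_multiple phi 'X_i) ->
  (forall i, power_in_jacobian V i) -> (forall i, power_in_jacobian W i) ->
  orbifold_mf w V W.
Proof.
move=> w_bd hV hW hphi hb Fab phi_gen jV jW.
have w_neq0 i : tnth w i != 0 by rewrite gt_eqF //; case/andP: (w_bd i).
have w_neq2 i : 2 - tnth w i != 0.
  by rewrite subr_eq0 eq_sym lt_eqF //; case/andP: (w_bd i).
have /fin_all_exists[ga gaP] (i : 'I_3) : exists r : 'I_3 -> {mpoly C[3]},
    'X_i = \sum_j r j * phi j by apply: ideal_multipleP.
have gaP' i : 'X_i = \sum_j (\matrix_(i, j) ga i j) i j * phi j.
  by rewrite {1}gaP; apply: eq_bigr => j _; rewrite mxE.
have phi0 i : (phi i).@[fun=> 0] = 0 by apply: whomog_eval0 (hphi i) _.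
have d0 (U : {mpoly C[3]}) (hU : whomog w 2 U) i : U^`M(i).@[fun=> 0] = 0.
  by apply: whomog_eval0 (whomog_mderiv hU) _.
have [NV [cV cVP]] := power_in_jacobian_datum jV.
have [NW [cW cWP]] := power_in_jacobian_datum jW.
have Fab' : iny 3 W - inx 3 V =
    \sum_i (iny 3 (phi i) - 'X_(lshift 3 i)) * b i.
  by rewrite Fab; apply: eq_bigr => i _; rewrite inxX.
exists (koszul_mf Fab'); split.
- apply: (@koszul_graded _ _ _ _ _ _ Fab' (tnth w)) => // i.
  apply: whomogD; first exact: whomog_iny.
  by apply: whomogN; rewrite -inxX; apply/whomog_inx/whomogX.
- exact: (koszul_qdiml Fab' gaP' phi0 (d0 _ hV) cWP).
- exact: (koszul_qdimr Fab' gaP' phi0 (d0 _ hW) cVP).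
Qed.
End Criterion.

Section Orbifold.
Variable R : realType.

Lemma whomog_potential (w : 3.-tuple rat) (W : {mpoly R[i][3]}) :
  (forall i, 0 < tnth w i < 2) -> whomog w 2 W ->
  (forall i, power_in_jacobian W i) -> potential w W.
Proof.
move=> w_bd hW jW; split; first by move=> i; case/andP: (w_bd i).
  exact: whomog_homogeneous2.
split; first exact: whomog_eval0 hW _.
  move=> i; apply: whomog_eval0 (whomog_mderiv hW) _.
  by rewrite subr_eq0 eq_sym lt_eqF //; case/andP: (w_bd i).
(* The radius 1 is arbitrary: the origin is the only critical point at all. *)
exists 1 => // v _ crit i; have [k k_gt0 /ideal_multipleP[r]] := jW i.
move/(congr1 (meval v)); rewrite rmorphXn /= mevalXU rmorph_sum big1 /=.
  by move/eqP; rewrite expf_eq0 k_gt0 => /eqP.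
by move=> j _; rewrite mevalM crit mulr0.
Qed.

Lemma orbifold_mf_equivalent (w : 3.-tuple rat) (V W : {mpoly R[i][3]}) :
  (forall i, 0 < tnth w i < 2) -> whomog w 2 V -> whomog w 2 W ->
  (forall i, power_in_jacobian V i) -> (forall i, power_in_jacobian W i) ->
  orbifold_mf w V W -> orbifold_equivalent w V w W.
Proof. by move=> w_bd hV hW jV jW M; split=> //; apply: whomog_potential. Qed.

End Orbifold.

(** * The potentials *)

Definition vec3 (T : Type) (a b c : T) (i : 'I_3) : T := nth a [:: a; b; c] i.

(** * Powers of the variables in the Jacobian ideals *)

Section Jacobians.
Variable K : numFieldType.
Local Notation x := ('X_ix : {mpoly K[3]}).
Local Notation y := ('X_iy : {mpoly K[3]}).
Local Notation z := ('X_iz : {mpoly K[3]}).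

Lemma mderiv_exp n i k (p : {mpoly K[n]}) :
  (p ^+ k.+1)^`M(i) = k.+1%:R * p ^+ k * p^`M(i).
Proof.
elim: k => [|k IHk]; first by rewrite expr1 expr0 mulr1 mul1r.
rewrite exprS mderivM IHk exprS -[k.+2%:R]natr1.
by move: (k.+1%:R) (p ^+ k) => c q; ring.
Qed.

Lemma mderiv_var :
  ((x^`M(ix) = 1) * (x^`M(iy) = 0) * (x^`M(iz) = 0) *
  (y^`M(ix) = 0) * (y^`M(iy) = 1) * (y^`M(iz) = 0) *
  (z^`M(ix) = 0) * (z^`M(iy) = 0) * (z^`M(iz) = 1))%type.
Proof. by do !split; rewrite mderivXU. Qed.

(** The successors make the exponent positive and, in characteristic 0, the coefficient nonzero;
    only a polynomial identity is left to check. *)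
Lemma power_in_jacobianI (W : {mpoly K[3]}) i k c (r0 r1 r2 : {mpoly K[3]}) :
  c.+1%:R * 'X_i ^+ k.+1 = r0 * W^`M(ix) + r1 * W^`M(iy) + r2 * W^`M(iz) ->
  power_in_jacobian W i.
Proof.
move=> e; exists k.+1 => //; exists c.+1%:R, (vec3 r0 r1 r2).
by rewrite pnatr_eq0 big_ord3 /vec3 /= -e rmorph_nat.
Qed.

(* [power_by k c r0 r1 r2] writes (c + 1) 'X_i ^ (k + 1) as a combination of the
   partial derivatives. *)
Tactic Notation "power_by" uconstr(k) uconstr(c)
    uconstr(r0) uconstr(r1) uconstr(r2) :=
  refine (@power_in_jacobianI _ _ k c r0 r1 r2 _);
  rewrite !(mderivD, mderivM, mderiv_exp, mderiv_var); ring.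

(** The multipliers come from eliminating mixed monomials between 3 x^2 z + z^2 and x^3 + 2 x z
    until a pure power remains. The other potentials are handled by the same kind of elimination. *)
Lemma jacobian_Q12V i : power_in_jacobian (x ^+ 3 * z + y ^+ 3 + x * z ^+ 2) i.
Proof.
elim/ord3_cases: i.
- power_by 4 4 (- 4 * x) 0 (5 * x ^+ 2 + 2 * z).
- power_by 1 2 0 1 0.
- power_by 2 4 (5 * z + 3 * x ^+ 2) 0 (- 9 * x * z).
Qed.

Lemma jacobian_Q12W i : power_in_jacobian (x ^+ 5 + y ^+ 3 + x * z ^+ 2) i.
Proof.
elim/ord3_cases: i.
- power_by 4 9 (2 * x) 0 (- z).
- power_by 1 2 0 1 0.
- power_by 2 1 (2 * z) 0 (- 5 * x ^+ 3).
Qed.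

Lemma jacobian_U12A i : power_in_jacobian (x ^+ 4 + y ^+ 3 + z ^+ 3) i.
Proof.
elim/ord3_cases: i.
- power_by 2 3 1 0 0.
- power_by 1 2 0 1 0.
- power_by 1 2 0 0 1.
Qed.

Lemma jacobian_U12B i : power_in_jacobian (x ^+ 4 + y ^+ 3 + z ^+ 2 * y) i.
Proof.
elim/ord3_cases: i.
- power_by 2 3 1 0 0.
- power_by 2 5 0 (2 * y) (- z).
- power_by 2 1 0 (2 * z) (- 3 * y).
Qed.

Lemma jacobian_U12C i :
  power_in_jacobian (x ^+ 4 + y ^+ 2 * z + z ^+ 2 * y) i.
Proof.
elim/ord3_cases: i.
- power_by 2 3 1 0 0.
- power_by 2 2 0 (- 4 * y) (3 * y + 2 * z).
- power_by 2 2 0 (3 * z + 2 * y) (- 4 * z).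
Qed.

Lemma jacobian_W12V i : power_in_jacobian (x ^+ 5 + y ^+ 2 * z + z ^+ 2) i.
Proof.
elim/ord3_cases: i.
- power_by 3 4 1 0 0.
- power_by 2 0 0 (- 1) y.
- power_by 1 3 0 (- y) (2 * z).
Qed.

Lemma jacobian_W12W i : power_in_jacobian (x ^+ 5 + y ^+ 4 + z ^+ 2) i.
Proof.
elim/ord3_cases: i.
- power_by 3 4 1 0 0.
- power_by 2 3 0 1 0.
- power_by 0 1 0 0 1.
Qed.

Lemma jacobian_W13V i : power_in_jacobian (y * x ^+ 4 + y ^+ 2 * z + z ^+ 2) i.
Proof.
elim/ord3_cases: i.
(* The y-derivative times x^3 is x^7 + 2 x^3 y z; the z-derivative replaces z by - y^2 / 2, and the
   resulting x^3 y^3 is a multiple of the x-derivative. *)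
- power_by 6 3 (y ^+ 2) (4 * x ^+ 3) (- 4 * x ^+ 3 * y).
- power_by 3 3 x (- 4 * y) (4 * y ^+ 2).
- power_by 1 15 x (- 4 * y) (8 * z).
Qed.

Lemma jacobian_W13W i : power_in_jacobian (x ^+ 4 * y + y ^+ 4 + z ^+ 2) i.
Proof.
elim/ord3_cases: i.
- power_by 6 0 (- y ^+ 2) (x ^+ 3) 0.
- power_by 3 15 (- x) (4 * y) 0.
- power_by 0 1 0 0 1.
Qed.

Lemma jacobian_Z13V i : power_in_jacobian (x ^+ 3 * z + x * y ^+ 3 + z ^+ 2) i.
Proof.
elim/ord3_cases: i.
- power_by 5 8 (- 6 * x) (2 * y) (9 * x ^+ 3).
- power_by 4 1 (2 * y ^+ 2) (x ^+ 4) (- 3 * x ^+ 2 * y ^+ 2).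
- power_by 1 35 (- 6 * x) (2 * y) (18 * z).
Qed.

Lemma jacobian_Z13W i : power_in_jacobian (x ^+ 6 + y ^+ 3 * x + z ^+ 2) i.
Proof.
elim/ord3_cases: i.
- power_by 5 17 (3 * x) (- y) 0.
- power_by 4 0 (y ^+ 2) (- 2 * x ^+ 4) 0.
- power_by 0 1 0 0 1.
Qed.
End Jacobians.

(** * Automatic computation of weighted degrees *)

Section Cast.
Variables (K : comNzRingType) (n : nat) (w : n.-tuple rat).
Implicit Types (p : {mpoly K[n]}).

Lemma whomog_cast q q' p : whomog w q p -> q = q' -> whomog w q' p.
Proof. by move=> ? <-. Qed.

Lemma whomogD_cast q1 q2 p1 p2 :
  whomog w q1 p1 -> whomog w q2 p2 -> q2 = q1 -> whomog w q1 (p1 + p2).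
Proof. by move=> h1 h2 e; apply: whomogD => //; rewrite -e. Qed.

Lemma whomog_nat k : whomog w 0 (k%:R : {mpoly K[n]}).
Proof. by rewrite -(rmorph_nat (@mpolyC n K)); apply: whomogC. Qed.
End Cast.

Ltac rat_eq := by apply/eqP; vm_compute.

(** The degree is an existential variable filled in from the leaves upwards; only sums leave an
    equation between rationals, which is decided by computation. *)
Ltac whomog_infer := lazymatch goal with
  | |- whomog _ _ (inx _ _) => apply: whomog_inx; whomog_infer
  | |- whomog _ _ (iny _ _) => apply: whomog_iny; whomog_infer
  | |- whomog _ _ (_ + _) =>
      eapply whomogD_cast; [whomog_infer | whomog_infer | rat_eq]
  | |- whomog _ _ (_%:R) => eapply whomog_nat
  | |- whomog _ _ (- _) => apply: whomogN; whomog_infer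
  | |- whomog _ _ (_ * _) =>
      eapply whomogM; [whomog_infer | whomog_infer | reflexivity]
  | |- whomog _ _ (_ ^+ _) => eapply whomogXn; [whomog_infer | reflexivity]
  | |- whomog _ _ (mpolyC _ _) => eapply whomogC
  | |- whomog _ _ (mpolyX _ _) => eapply whomogX
  end.

Ltac whomog := eapply whomog_cast; [whomog_infer | rat_eq].

Lemma ideal_multipleI (K : fieldType) (phi : 'I_3 -> {mpoly K[3]})
    p c r0 r1 r2 :
  c != 0 -> c%:MP * p = r0 * phi ix + r1 * phi iy + r2 * phi iz ->
  ideal_multiple phi p.
Proof.
by move=> c0 e; exists c, (vec3 r0 r1 r2); rewrite big_ord3 /vec3 /= -e.
Qed.

(** * Difference quotients of the potentials *)

Section DifferenceQuotients.
Variable S : comNzRingType.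
Implicit Types p q r x y z : S.

(** Telescoping: [p], [q], [r] are replaced by [x], [y], [z] one after the other, and each
    replacement splits off one linear factor. The cofactors are the [b] of the Koszul pairs; the
    later quotients arise in the same way. *)
Lemma Q12_quotient p q r x y z :
  p ^+ 3 * r + q ^+ 3 + p * r ^+ 2 - (x ^+ 3 * z + y ^+ 3 + x * z ^+ 2) =
  (p - x) * ((p ^+ 2 + p * x + x ^+ 2) * r + r ^+ 2) +
  (q - y) * (q ^+ 2 + q * y + y ^+ 2) +
  (r - z) * (x ^+ 3 + x * (r + z)).
Proof. ring. Qed.

Lemma U12AB_quotient p q r x y z :
  p ^+ 4 + q ^+ 3 + r ^+ 3 - (x ^+ 4 + y ^+ 3 + z ^+ 3) =
  (p - x) * ((p + x) * (p ^+ 2 + x ^+ 2)) +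
  (q - y) * (q ^+ 2 + q * y + y ^+ 2) +
  (r - z) * (r ^+ 2 + r * z + z ^+ 2).
Proof. ring. Qed.

Lemma U12BC_quotient p q r x y z :
  p ^+ 4 + q ^+ 3 + r ^+ 2 * q - (x ^+ 4 + y ^+ 3 + z ^+ 2 * y) =
  (p - x) * ((p + x) * (p ^+ 2 + x ^+ 2)) +
  (q - y) * (q ^+ 2 + q * y + y ^+ 2 + r ^+ 2) +
  (r - z) * (y * (r + z)).
Proof. ring. Qed.

Lemma W12_quotient p q r x y z :
  p ^+ 5 + q ^+ 2 * r + r ^+ 2 - (x ^+ 5 + y ^+ 2 * z + z ^+ 2) =
  (p - x) * (p ^+ 4 + p ^+ 3 * x + p ^+ 2 * x ^+ 2 + p * x ^+ 3 + x ^+ 4) +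
  (q - y) * ((q + y) * r) +
  (r - z) * (y ^+ 2 + r + z).
Proof. ring. Qed.

Lemma W13_quotient p q r x y z :
  q * p ^+ 4 + q ^+ 2 * r + r ^+ 2 - (y * x ^+ 4 + y ^+ 2 * z + z ^+ 2) =
  (p - x) * (q * (p + x) * (p ^+ 2 + x ^+ 2)) +
  (q - y) * (x ^+ 4 + (q + y) * r) +
  (r - z) * (y ^+ 2 + r + z).
Proof. ring. Qed.

Lemma Z13_quotient p q r x y z :
  p ^+ 3 * r + p * q ^+ 3 + r ^+ 2 - (x ^+ 3 * z + x * y ^+ 3 + z ^+ 2) =
  (p - x) * ((p ^+ 2 + p * x + x ^+ 2) * r + q ^+ 3) +
  (q - y) * (x * (q ^+ 2 + q * y + y ^+ 2)) +
  (r - z) * (x ^+ 3 + r + z).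
Proof. ring. Qed.

End DifferenceQuotients.

Ltac weights := by elim/ord3_cases; apply/andP; split; vm_compute.

(** * The coordinate changes *)

Section Cases.
Variable K : numClosedFieldType.
Local Notation x := ('X_ix : {mpoly K[3]}).
Local Notation y := ('X_iy : {mpoly K[3]}).
Local Notation z := ('X_iz : {mpoly K[3]}).

Lemma scaled_root k (c u : K) :
  c != 0 -> u != 0 -> exists2 e, e != 0 & c * e ^+ k.+1 = u.
Proof.
move=> c_neq0 u_neq0; exists (k.+1.-root (u / c)).
  by rewrite rootC_eq0 // mulf_neq0 ?invr_eq0.
by rewrite rootCK // mulrC divfK.
Qed.

Tactic Notation "generated_by" uconstr(c) uconstr(r0) uconstr(r1) uconstr(r2) :=
  refine (@ideal_multipleI _ _ _ c r0 r1 r2 _ _);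
  [by rewrite ?mulf_neq0 ?oner_eq0 ?pnatr_eq0 | rewrite /vec3 /=; ring].

Lemma Q12_mf : orbifold_mf (degrees3 (6 / 15) (10 / 15) (12 / 15))
  (x ^+ 3 * z + y ^+ 3 + x * z ^+ 2) (x ^+ 5 + y ^+ 3 + x * z ^+ 2).
Proof.
(* Completing the square, p^3 r + p r^2 = p (r + p^2 / 2)^2 - p^5 / 4. Putting p = 2 e x and r + p^2
   / 2 = d z leaves the conditions on [e] and [d]; the factor 2 avoids denominators. *)
have [e e_neq0 e5] : exists2 e : K, e != 0 & 8 * e ^+ 5 = - 1.
  by apply: scaled_root; rewrite ?oppr_eq0 ?oner_eq0 ?pnatr_eq0.
have [d d_neq0 d2] : exists2 d : K, d != 0 & 2 * e * d ^+ 2 = 1.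
  by apply: scaled_root; rewrite ?mulf_neq0 ?oner_eq0 ?pnatr_eq0.
pose phi : 'I_3 -> {mpoly K[3]} :=
  vec3 (2 * e%:MP * x) y (d%:MP * z - 2 * e%:MP ^+ 2 * x ^+ 2).
pose X i : {mpoly K[3 + 3]} := inx 3 'X_i; pose Y i := iny 3 (phi i).
pose b := vec3
  ((Y ix ^+ 2 + Y ix * X ix + X ix ^+ 2) * Y iz + Y iz ^+ 2)
  (Y iy ^+ 2 + Y iy * X iy + X iy ^+ 2)
  (X ix ^+ 3 + X ix * (Y iz + X iz)).
apply: (@coordinate_change_mf K _ _ _ phi b).
- weights.
- whomog.
- whomog.
- by elim/ord3_cases; rewrite /phi /vec3 /=; whomog.
- by elim/ord3_cases; rewrite /b /X /Y /phi /vec3 /=; whomog.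
- have -> : x ^+ 5 + y ^+ 3 + x * z ^+ 2 =
      phi ix ^+ 3 * phi iz + phi iy ^+ 3 + phi ix * phi iz ^+ 2.
    (* [ring] knows no relations between the constants, so the products fixed by [e5] and [d2] are
       isolated first. *)
    transitivity (- (8 * e ^+ 5)%:MP * x ^+ 5 + y ^+ 3 +
      (2 * e * d ^+ 2)%:MP * (x * z ^+ 2)).
      by rewrite e5 d2; ring.
    by rewrite /phi /vec3 /=; ring.
  rewrite big_ord3 /b /vec3 /= /X /Y !(inxD, inyD, inxM, inyM, inxXn, inyXn).
  exact: Q12_quotient.
- elim/ord3_cases; rewrite /phi.
  + by generated_by (2 * e) 1 0 0.
  + by generated_by 1 0 1 0.
  + by generated_by d (e%:MP * x) 0 1.
- exact: jacobian_Q12V.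
- exact: jacobian_Q12W.
Qed.

Lemma U12AB_mf : orbifold_mf (degrees3 (6 / 12) (8 / 12) (8 / 12))
  (x ^+ 4 + y ^+ 3 + z ^+ 3) (x ^+ 4 + y ^+ 3 + z ^+ 2 * y).
Proof.
(* In (p y + q z)^3 + (p y - q z)^3 only 2 p^3 y^3 + 6 p q^2 y z^2 survives. *)
have [p p_neq0 p3] : exists2 p : K, p != 0 & 2 * p ^+ 3 = 1.
  by apply: scaled_root; rewrite ?oner_eq0 ?pnatr_eq0.
have [q q_neq0 q2] : exists2 q : K, q != 0 & 6 * p * q ^+ 2 = 1.
  by apply: scaled_root; rewrite ?mulf_neq0 ?oner_eq0 ?pnatr_eq0.
pose phi : 'I_3 -> {mpoly K[3]} :=
  vec3 x (p%:MP * y + q%:MP * z) (p%:MP * y - q%:MP * z).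
pose X i : {mpoly K[3 + 3]} := inx 3 'X_i; pose Y i := iny 3 (phi i).
pose b := vec3
  ((Y ix + X ix) * (Y ix ^+ 2 + X ix ^+ 2))
  (Y iy ^+ 2 + Y iy * X iy + X iy ^+ 2)
  (Y iz ^+ 2 + Y iz * X iz + X iz ^+ 2).
apply: (@coordinate_change_mf K _ _ _ phi b).
- weights.
- whomog.
- whomog.
- by elim/ord3_cases; rewrite /phi /vec3 /=; whomog.
- by elim/ord3_cases; rewrite /b /X /Y /phi /vec3 /=; whomog.
- have -> : x ^+ 4 + y ^+ 3 + z ^+ 2 * y =
      phi ix ^+ 4 + phi iy ^+ 3 + phi iz ^+ 3.
    transitivity (x ^+ 4 + (2 * p ^+ 3)%:MP * y ^+ 3 +
      (6 * p * q ^+ 2)%:MP * (z ^+ 2 * y)).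
      by rewrite p3 q2; ring.
    by rewrite /phi /vec3 /=; ring.
  rewrite big_ord3 /b /vec3 /= /X /Y !(inxD, inyD, inxM, inyM, inxXn, inyXn).
  exact: U12AB_quotient.
- elim/ord3_cases; rewrite /phi.
  + by generated_by 1 1 0 0.
  + by generated_by (2 * p) 0 1 1.
  + by generated_by (2 * q) 0 1 (- 1).
- exact: jacobian_U12A.
- exact: jacobian_U12B.
Qed.

Lemma U12BC_mf : orbifold_mf (degrees3 (6 / 12) (8 / 12) (8 / 12))
  (x ^+ 4 + y ^+ 3 + z ^+ 2 * y) (x ^+ 4 + y ^+ 2 * z + z ^+ 2 * y).
Proof.
(* With q^2 = - p^2 the cubic becomes p^3 (y + z) ((y + z)^2 - (y - z)^2) = 4 p^3 y z (y + z). *)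
have [p p_neq0 p3] : exists2 p : K, p != 0 & 4 * p ^+ 3 = 1.
  by apply: scaled_root; rewrite ?oner_eq0 ?pnatr_eq0.
have [q q_neq0 q2] : exists2 q : K, q != 0 & 1 * q ^+ 2 = - p ^+ 2.
  by apply: scaled_root; rewrite ?oppr_eq0 ?expf_eq0 ?oner_eq0.
pose phi : 'I_3 -> {mpoly K[3]} :=
  vec3 x (p%:MP * (y + z)) (q%:MP * (y - z)).
pose X i : {mpoly K[3 + 3]} := inx 3 'X_i; pose Y i := iny 3 (phi i).
pose b := vec3
  ((Y ix + X ix) * (Y ix ^+ 2 + X ix ^+ 2))
  (Y iy ^+ 2 + Y iy * X iy + X iy ^+ 2 + Y iz ^+ 2)
  (X iy * (Y iz + X iz)).
apply: (@coordinate_change_mf K _ _ _ phi b).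
- weights.
- whomog.
- whomog.
- by elim/ord3_cases; rewrite /phi /vec3 /=; whomog.
- by elim/ord3_cases; rewrite /b /X /Y /phi /vec3 /=; whomog.
- have -> : x ^+ 4 + y ^+ 2 * z + z ^+ 2 * y =
      phi ix ^+ 4 + phi iy ^+ 3 + phi iz ^+ 2 * phi iy.
    transitivity (x ^+ 4 + (4 * p ^+ 3)%:MP * (y ^+ 2 * z + z ^+ 2 * y) +
        (1 * q ^+ 2 + p ^+ 2)%:MP * p%:MP * (y + z) * (y - z) ^+ 2).
      by rewrite p3 q2; ring.
    by rewrite /phi /vec3 /=; ring.
  rewrite big_ord3 /b /vec3 /= /X /Y !(inxD, inyD, inxM, inyM, inxXn, inyXn).
  exact: U12BC_quotient.
- elim/ord3_cases; rewrite /phi.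
  + by generated_by 1 1 0 0.
  + by generated_by (2 * p * q) 0 (q%:MP) (p%:MP).
  + by generated_by (2 * p * q) 0 (q%:MP) (- p%:MP).
- exact: jacobian_U12B.
- exact: jacobian_U12C.
Qed.

Lemma W12_mf : orbifold_mf (degrees3 (8 / 20) (10 / 20) (20 / 20))
  (x ^+ 5 + y ^+ 2 * z + z ^+ 2) (x ^+ 5 + y ^+ 4 + z ^+ 2).
Proof.
(* Here q^2 r + r^2 = (r + q^2 / 2)^2 - q^4 / 4 with q = 2 t y and r + q^2 / 2 = z, so y^4 gets the
   coefficient - 4 t^4. *)
have [t t_neq0 t4] : exists2 t : K, t != 0 & 4 * t ^+ 4 = - 1.
  by apply: scaled_root; rewrite ?oppr_eq0 ?oner_eq0 ?pnatr_eq0.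
pose phi : 'I_3 -> {mpoly K[3]} :=
  vec3 x (2 * t%:MP * y) (z - 2 * t%:MP ^+ 2 * y ^+ 2).
pose X i : {mpoly K[3 + 3]} := inx 3 'X_i; pose Y i := iny 3 (phi i).
pose b := vec3
  (Y ix ^+ 4 + Y ix ^+ 3 * X ix + Y ix ^+ 2 * X ix ^+ 2 +
   Y ix * X ix ^+ 3 + X ix ^+ 4)
  ((Y iy + X iy) * Y iz)
  (X iy ^+ 2 + Y iz + X iz).
apply: (@coordinate_change_mf K _ _ _ phi b).
- weights.
- whomog.
- whomog.
- by elim/ord3_cases; rewrite /phi /vec3 /=; whomog.
- by elim/ord3_cases; rewrite /b /X /Y /phi /vec3 /=; whomog.
- have -> : x ^+ 5 + y ^+ 4 + z ^+ 2 =
      phi ix ^+ 5 + phi iy ^+ 2 * phi iz + phi iz ^+ 2.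
    transitivity (x ^+ 5 - (4 * t ^+ 4)%:MP * y ^+ 4 + z ^+ 2).
      by rewrite t4; ring.
    by rewrite /phi /vec3 /=; ring.
  rewrite big_ord3 /b /vec3 /= /X /Y !(inxD, inyD, inxM, inyM, inxXn, inyXn).
  exact: W12_quotient.
- elim/ord3_cases; rewrite /phi.
  + by generated_by 1 1 0 0.
  + by generated_by (2 * t) 0 1 0.
  + by generated_by 1 0 (t%:MP * y) 1.
- exact: jacobian_W12V.
- exact: jacobian_W12W.
Qed.

Lemma W13_mf : orbifold_mf (degrees3 (6 / 16) (8 / 16) (16 / 16))
  (y * x ^+ 4 + y ^+ 2 * z + z ^+ 2) (x ^+ 4 * y + y ^+ 4 + z ^+ 2).
Proof.
have [t t_neq0 t4] : exists2 t : K, t != 0 & 4 * t ^+ 4 = - 1.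
  by apply: scaled_root; rewrite ?oppr_eq0 ?oner_eq0 ?pnatr_eq0.
(* The square is completed as for W12; [s] compensates the factor 2 t that this brings into y
   x^4. *)
have [s s_neq0 s4] : exists2 s : K, s != 0 & 2 * t * s ^+ 4 = 1.
  by apply: scaled_root; rewrite ?mulf_neq0 ?oner_eq0 ?pnatr_eq0.
pose phi : 'I_3 -> {mpoly K[3]} :=
  vec3 (s%:MP * x) (2 * t%:MP * y) (z - 2 * t%:MP ^+ 2 * y ^+ 2).
pose X i : {mpoly K[3 + 3]} := inx 3 'X_i; pose Y i := iny 3 (phi i).
pose b := vec3
  (Y iy * (Y ix + X ix) * (Y ix ^+ 2 + X ix ^+ 2))
  (X ix ^+ 4 + (Y iy + X iy) * Y iz)
  (X iy ^+ 2 + Y iz + X iz).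
apply: (@coordinate_change_mf K _ _ _ phi b).
- weights.
- whomog.
- whomog.
- by elim/ord3_cases; rewrite /phi /vec3 /=; whomog.
- by elim/ord3_cases; rewrite /b /X /Y /phi /vec3 /=; whomog.
- have -> : x ^+ 4 * y + y ^+ 4 + z ^+ 2 =
      phi iy * phi ix ^+ 4 + phi iy ^+ 2 * phi iz + phi iz ^+ 2.
    transitivity ((2 * t * s ^+ 4)%:MP * (x ^+ 4 * y) -
      (4 * t ^+ 4)%:MP * y ^+ 4 + z ^+ 2).
      by rewrite s4 t4; ring.
    by rewrite /phi /vec3 /=; ring.
  rewrite big_ord3 /b /vec3 /= /X /Y !(inxD, inyD, inxM, inyM, inxXn, inyXn).
  exact: W13_quotient.
- elim/ord3_cases; rewrite /phi.
  + by generated_by s 1 0 0.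
  + by generated_by (2 * t) 0 1 0.
  + by generated_by 1 0 (t%:MP * y) 1.
- exact: jacobian_W13V.
- exact: jacobian_W13W.
Qed.

Lemma Z13_mf : orbifold_mf (degrees3 (6 / 18) (10 / 18) (18 / 18))
  (x ^+ 3 * z + x * y ^+ 3 + z ^+ 2) (x ^+ 6 + y ^+ 3 * x + z ^+ 2).
Proof.
(* Here p^3 r + r^2 = (r + p^3 / 2)^2 - p^6 / 4 with p = 2 e x and r + p^3 / 2 = z; [d] then
   compensates the factor 2 e in x y^3. *)
have [e e_neq0 e6] : exists2 e : K, e != 0 & 16 * e ^+ 6 = - 1.
  by apply: scaled_root; rewrite ?oppr_eq0 ?oner_eq0 ?pnatr_eq0.
have [d d_neq0 d3] : exists2 d : K, d != 0 & 2 * e * d ^+ 3 = 1.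
  by apply: scaled_root; rewrite ?mulf_neq0 ?oner_eq0 ?pnatr_eq0.
pose phi : 'I_3 -> {mpoly K[3]} :=
  vec3 (2 * e%:MP * x) (d%:MP * y) (z - 4 * e%:MP ^+ 3 * x ^+ 3).
pose X i : {mpoly K[3 + 3]} := inx 3 'X_i; pose Y i := iny 3 (phi i).
pose b := vec3
  ((Y ix ^+ 2 + Y ix * X ix + X ix ^+ 2) * Y iz + Y iy ^+ 3)
  (X ix * (Y iy ^+ 2 + Y iy * X iy + X iy ^+ 2))
  (X ix ^+ 3 + Y iz + X iz).
apply: (@coordinate_change_mf K _ _ _ phi b).
- weights.
- whomog.
- whomog.
- by elim/ord3_cases; rewrite /phi /vec3 /=; whomog.
- by elim/ord3_cases; rewrite /b /X /Y /phi /vec3 /=; whomog.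
- have -> : x ^+ 6 + y ^+ 3 * x + z ^+ 2 =
      phi ix ^+ 3 * phi iz + phi ix * phi iy ^+ 3 + phi iz ^+ 2.
    transitivity (- (16 * e ^+ 6)%:MP * x ^+ 6 +
      (2 * e * d ^+ 3)%:MP * (y ^+ 3 * x) + z ^+ 2).
      by rewrite e6 d3; ring.
    by rewrite /phi /vec3 /=; ring.
  rewrite big_ord3 /b /vec3 /= /X /Y !(inxD, inyD, inxM, inyM, inxXn, inyXn).
  exact: Z13_quotient.
- elim/ord3_cases; rewrite /phi.
  + by generated_by (2 * e) 1 0 0.
  + by generated_by d 0 1 0.
  + by generated_by 1 (2 * e%:MP ^+ 2 * x ^+ 2) 0 1.
- exact: jacobian_Z13V.
- exact: jacobian_Z13W.
Qed.

End Cases.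

Theorem theorem1p5 (R : realType) :
  let x : {mpoly R[i][3]} := 'X_(@Ordinal 3 0 isT) in
  let y : {mpoly R[i][3]} := 'X_(@Ordinal 3 1 isT) in
  let z : {mpoly R[i][3]} := 'X_(@Ordinal 3 2 isT) in
  let orb_eq (w : 3.-tuple rat) (V W : {mpoly R[i][3]}) :=
    orbifold_equivalent w V w W in
  let Q12 := degrees3 (6 / 15) (10 / 15) (12 / 15) in
  let U12 := degrees3 (6 / 12) (8 / 12) (8 / 12) in
  let W12 := degrees3 (8 / 20) (10 / 20) (20 / 20) in
  let W13 := degrees3 (6 / 16) (8 / 16) (16 / 16) in
  let Z13 := degrees3 (6 / 18) (10 / 18) (18 / 18) in
  [/\ orb_eq Q12 (x ^+ 3 * z + y ^+ 3 + x * z ^+ 2) (x ^+ 5 + y ^+ 3 + x * z ^+ 2),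
      orb_eq U12 (x ^+ 4 + y ^+ 3 + z ^+ 3) (x ^+ 4 + y ^+ 3 + z ^+ 2 * y)
      /\ orb_eq U12 (x ^+ 4 + y ^+ 3 + z ^+ 2 * y)
                 (x ^+ 4 + y ^+ 2 * z + z ^+ 2 * y),
      orb_eq W12 (x ^+ 5 + y ^+ 2 * z + z ^+ 2) (x ^+ 5 + y ^+ 4 + z ^+ 2),
      orb_eq W13 (y * x ^+ 4 + y ^+ 2 * z + z ^+ 2)
              (x ^+ 4 * y + y ^+ 4 + z ^+ 2) &
      orb_eq Z13 (x ^+ 3 * z + x * y ^+ 3 + z ^+ 2)
              (x ^+ 6 + y ^+ 3 * x + z ^+ 2)].
Proof.
cbv zeta; split.
- apply: orbifold_mf_equivalent; [weights | whomog | whomog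
  | exact: jacobian_Q12V | exact: jacobian_Q12W | exact: Q12_mf].
- split; apply: orbifold_mf_equivalent; [weights | whomog | whomog
  | exact: jacobian_U12A | exact: jacobian_U12B | exact: U12AB_mf
  | weights | whomog | whomog
  | exact: jacobian_U12B | exact: jacobian_U12C | exact: U12BC_mf].
- apply: orbifold_mf_equivalent; [weights | whomog | whomog
  | exact: jacobian_W12V | exact: jacobian_W12W | exact: W12_mf].
- apply: orbifold_mf_equivalent; [weights | whomog | whomog
  | exact: jacobian_W13V | exact: jacobian_W13W | exact: W13_mf].
- apply: orbifold_mf_equivalent; [weights | whomog | whomog
  | exact: jacobian_Z13V | exact: jacobian_Z13W | exact: Z13_mf].
Qed.
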